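(* The logics $\mathsf{MFO{+}C}$ and $\mathsf{GFO{+}C}$ have the same expressivity: a unary query on $\ell$-labelled graphs is expressible in $\mathsf{MFO{+}C}$ if and only if it is expressible in $\mathsf{GFO{+}C}$.
   Context: Graphs are finite, simple and undirected. For unary relation symbols $P_1,\dots,P_\ell$, an $\ell$-labelled graph $G$ consists of a vertex set $V(G)$, a symmetric irreflexive edge relation $E(G)$, and unary relations $P_i(G)\subseteq V(G)$. A unary query $\mathcal Q$ maps each $\ell$-labelled graph $G$ to a set $\mathcal Q(G)\subseteq V(G)$ such that every isomorphism $h:G\to H$ satisfies $h(\mathcal Q(G))=\mathcal Q(H)$. The logic $\mathsf{FO{+}C}$ is two-sorted: vertex variables range over $V(G)$, number variables range over $\mathbb N$. Terms are: number variables; the constants $0,1,\mathrm{ord}$ (where $\mathrm{ord}$ is interpreted as $|V(G)|$); $\theta+\theta'$ and $\theta\cdot\theta'$ for terms $\theta,\theta'$; and counting terms $\#(x_1,\dots,x_k,y_1<\theta_1,\dots,y_\ell<\theta_\ell).\psi$ (vertex variables $x_i$, number variables $y_j$, terms $\theta_j$, formula $\psi$), whose value is the number of tuples $(v_1,\dots,v_k,i_1,\dots,i_\ell)\in V(G)^k\times\mathbb N^\ell$ such that each $i_j$ is smaller than the value of $\theta_j$ and $\psi$ holds when $x_i\mapsto v_i$, $y_j\mapsto i_j$; such a term binds the $x_i,y_j$. Formulas are atomic formulas $E(x,x')$, $P_i(x)$, $x=x'$ (vertex variables) and $\theta\le\theta'$ (terms), closed under Boolean connectives. (Quantifiers are expressible,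 e.g. $\exists x.\phi$ as $1\le \#x.\phi$.) $\mathsf{MFO{+}C}$ uses only the two vertex variables $x_1,x_2$ (and arbitrary number variables) and its terms and formulas are defined inductively: (i) number variables, $0,1,\mathrm{ord}$ are terms; (ii) $\theta+\theta'$, $\theta\cdot\theta'$ are terms for terms $\theta,\theta'$; (iii) $\theta\le\theta'$ is a formula; (iv) $x_i=x_j$, $E(x_i,x_j)$, $P(x_i)$ are formulas ($i,j\in\{1,2\}$); Boolean combinations of formulas are formulas; (v) $\#(y_1<\theta_1,\dots,y_k<\theta_k).\psi$ is a term for number variables $y_j$, terms $\theta_j$ and formula $\psi$; (vi) $\#(x_{3-i},y_1<\theta_1,\dots,y_k<\theta_k).\big(E(x_i,x_{3-i})\wedge\psi\big)$ is a term for $i\in\{1,2\}$, terms $\theta_j$ and formula $\psi$ in which $x_i$ does not occur freely. $\mathsf{GFO{+}C}$ is defined by the same rules except that in (vi) the restriction that $x_i$ does not occur freely in $\psi$ is dropped. A unary query $\mathcal Q$ is expressible in a logic if there is a formula $\phi(x)$ of that logic with exactly one free vertex variable and no free number variables such that $\mathcal Q(G)=\{v\in V(G): G\models\phi(v)\}$ for all $\ell$-labelled graphs $G$. *)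

(* Defs.v *)
From Stdlib Require List.
From mathcomp Require Import all_boot.

Set Implicit Arguments.
Unset Strict Implicit.
Unset Printing Implicit Defensive.

Record lgraph (l : nat) : Type := LGraph {
  vertex :> finType;
  edge : rel vertex;
  label : 'I_l -> {set vertex};
  edge_sym : symmetric edge;
  edge_irrefl : irreflexive edge
}.

Record is_iso (l : nat) (G H : lgraph l) (h : G -> H) : Prop := IsIso {
  iso_bij : bijective h;
  iso_edge : forall u v : G, edge (h u) (h v) = edge u v;
  iso_label : forall (i : 'I_l) (v : G), (h v \in label H i) = (v \in label G i)
}.

Record unary_query (l : nat) : Type := UnaryQuery {
  query :> forall G : lgraph l, {set G};
  query_iso : forall (G H : lgraph l) (h : G -> H),
    is_iso h -> h @: query G = query H
}.

(* Both the vertex variables x_0, x_1, ... and the number variables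
   y_0, y_1, ... are named by natural numbers; the two sorts are kept apart by
   the constructors.  [TCount xs ys psi] is the counting term
   #(x, ..., y < theta, ...).psi, with [ys] listing the pairs (y, theta). *)
Inductive term (l : nat) : Type :=
| TVar of nat
| TZero
| TOne
| TOrd
| TAdd of term l & term l
| TMul of term l & term l
| TCount of seq nat & seq (nat * term l) & form l
with form (l : nat) : Type :=
| FEdge of nat & nat
| FLabel of 'I_l & nat
| FEq of nat & nat
| FLe of term l & term l
| FNot of form l
| FAnd of form l & form l
| FOr of form l & form l.

Arguments TVar {l}.
Arguments TZero {l}.
Arguments TOne {l}.
Arguments TOrd {l}.
Arguments FEdge {l}.
Arguments FEq {l}.

(* The bounds theta_j of a counting term are evaluated outside the scope of the
   variables it binds, so their free variables remain free. *)
Fixpoint tfree_vertex (l : nat) (t : term l) : seq nat :=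
  match t with
  | TVar _ | TZero | TOne | TOrd => [::]
  | TAdd t1 t2 | TMul t1 t2 => tfree_vertex t1 ++ tfree_vertex t2
  | TCount xs ys psi =>
      [seq x <- ffree_vertex psi | x \notin xs]
        ++ flatten [seq tfree_vertex p.2 | p <- ys]
  end
with ffree_vertex (l : nat) (phi : form l) : seq nat :=
  match phi with
  | FEdge x x' | FEq x x' => [:: x; x']
  | FLabel _ x => [:: x]
  | FLe t1 t2 => tfree_vertex t1 ++ tfree_vertex t2
  | FNot psi => ffree_vertex psi
  | FAnd psi1 psi2 | FOr psi1 psi2 => ffree_vertex psi1 ++ ffree_vertex psi2
  end.

Fixpoint tfree_number (l : nat) (t : term l) : seq nat :=
  match t with
  | TVar y => [:: y]
  | TZero | TOne | TOrd => [::]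
  | TAdd t1 t2 | TMul t1 t2 => tfree_number t1 ++ tfree_number t2
  | TCount xs ys psi =>
      [seq y <- ffree_number psi | y \notin map fst ys]
        ++ flatten [seq tfree_number p.2 | p <- ys]
  end
with ffree_number (l : nat) (phi : form l) : seq nat :=
  match phi with
  | FEdge _ _ | FEq _ _ | FLabel _ _ => [::]
  | FLe t1 t2 => tfree_number t1 ++ tfree_number t2
  | FNot psi => ffree_number psi
  | FAnd psi1 psi2 | FOr psi1 psi2 => ffree_number psi1 ++ ffree_number psi2
  end.

(* [update a xs vs] maps the j-th entry of [xs] to the j-th entry of [vs] and
   agrees with [a] off [xs]: there [index x xs = size xs], so that [nth]
   returns its default when [vs] is as long as [xs]. *)
Definition update (T : Type) (a : nat -> T) (xs : seq nat) (vs : seq T) :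
    nat -> T :=
  fun x => nth (a x) vs (index x xs).

(* In the value of a counting term the tuples of naturals are taken below the
   maximum [\max_(b <- bs) b] of the bounds, which only serves to make the type
   of tuples finite: the conjunct on [p.2] imposes the individual bounds. *)
Fixpoint term_value (l : nat) (G : lgraph l) (va : nat -> G) (na : nat -> nat)
    (t : term l) : nat :=
  match t with
  | TVar y => na y
  | TZero => 0
  | TOne => 1
  | TOrd => #|G|
  | TAdd t1 t2 => term_value va na t1 + term_value va na t2
  | TMul t1 t2 => term_value va na t1 * term_value va na t2
  | TCount xs ys psi =>
      let bs := [seq term_value va na p.2 | p <- ys] in
      #|[set p : (size xs).-tuple G * (size ys).-tuple 'I_(\max_(b <- bs) b) |
          [forall j, tnth p.2 j < nth 0 bs j]
          && holds (update va xs p.1)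
                   (update na (map fst ys) (map val p.2)) psi]|
  end
with holds (l : nat) (G : lgraph l) (va : nat -> G) (na : nat -> nat)
    (phi : form l) : bool :=
  match phi with
  | FEdge x x' => edge (va x) (va x')
  | FLabel i x => va x \in label G i
  | FEq x x' => va x == va x'
  | FLe t1 t2 => term_value va na t1 <= term_value va na t2
  | FNot psi => ~~ holds va na psi
  | FAnd psi1 psi2 => holds va na psi1 && holds va na psi2
  | FOr psi1 psi2 => holds va na psi1 || holds va na psi2
  end.

Inductive fragment : Type := Modal | Guarded.

(* The two vertex variables of the fragments are those named 1 and 2, so that
   [3 - i] names the other one.  The number variables bound by one counting
   term are required to be distinct. *)
Inductive fragment_term (l : nat) (L : fragment) : term l -> Prop :=
| fragment_TVar y : fragment_term L (TVar y)
| fragment_TZero : fragment_term L TZero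
| fragment_TOne : fragment_term L TOne
| fragment_TOrd : fragment_term L TOrd
| fragment_TAdd t1 t2 :
    fragment_term L t1 -> fragment_term L t2 -> fragment_term L (TAdd t1 t2)
| fragment_TMul t1 t2 :
    fragment_term L t1 -> fragment_term L t2 -> fragment_term L (TMul t1 t2)
| fragment_TCount_number (ys : seq (nat * term l)) psi :
    uniq (map fst ys) ->
    (forall (y : nat) theta, List.In (y, theta) ys -> fragment_term L theta) ->
    fragment_form L psi ->
    fragment_term L (TCount [::] ys psi)
| fragment_TCount_neighbour (i : nat) (ys : seq (nat * term l)) psi :
    i \in [:: 1; 2] ->
    uniq (map fst ys) ->
    (forall (y : nat) theta, List.In (y, theta) ys -> fragment_term L theta) ->
    fragment_form L psi ->
    (L = Modal -> i \notin ffree_vertex psi) ->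
    fragment_term L (TCount [:: 3 - i] ys (FAnd (FEdge i (3 - i)) psi))
with fragment_form (l : nat) (L : fragment) : form l -> Prop :=
| fragment_FEdge (i j : nat) :
    i \in [:: 1; 2] -> j \in [:: 1; 2] -> fragment_form L (FEdge i j)
| fragment_FLabel P (i : nat) : i \in [:: 1; 2] -> fragment_form L (FLabel P i)
| fragment_FEq (i j : nat) :
    i \in [:: 1; 2] -> j \in [:: 1; 2] -> fragment_form L (FEq i j)
| fragment_FLe t1 t2 :
    fragment_term L t1 -> fragment_term L t2 -> fragment_form L (FLe t1 t2)
| fragment_FNot psi : fragment_form L psi -> fragment_form L (FNot psi)
| fragment_FAnd psi1 psi2 :
    fragment_form L psi1 -> fragment_form L psi2 ->
    fragment_form L (FAnd psi1 psi2)
| fragment_FOr psi1 psi2 :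
    fragment_form L psi1 -> fragment_form L psi2 ->
    fragment_form L (FOr psi1 psi2).

Definition MFOC (l : nat) (phi : form l) : Prop := fragment_form Modal phi.
Definition GFOC (l : nat) (phi : form l) : Prop := fragment_form Guarded phi.

(* Since [x] is the only free variable of [phi], G |= phi(v) means that [phi]
   holds under any assignment with x |-> v. *)
Definition expressible (l : nat) (logic : form l -> Prop)
    (Q : unary_query l) : Prop :=
  exists (phi : form l) (x : nat),
    [/\ logic phi,
        ffree_vertex phi =i [:: x],
        ffree_number phi = [::] &
        forall (G : lgraph l) (va : nat -> G) (na : nat -> nat),
          (va x \in Q G) = holds va na phi].

(* Main.v *)
From mathcomp Require Import all_boot all_algebra zify.
Require Import Defs.

(* Modal formulas are guarded, so only the converse needs an argument.  In a guarded
   count of the neighbours w of v, the state of v (the values at v of finitely many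
   modal terms, as functions of boundedly many bounded number variables) is needed at
   w.  It is polynomially long, hence does not fit into number variables; instead v
   sends a hash of it.  View the state of u as a string s_u of length L and put
   H(u) = \sum_(i < L) s_u(i) / (q + i), the inverses being computed modulo a prime p.
   Two distinct strings collide for fewer than L values of q, since a collision makes
   q a root of a nonzero polynomial over F_p; so for p polynomially large some q
   separates all states occurring in the graph.  The vertex v picks p and q such that
   every neighbour of a neighbour of v with the same hash as v also has the same state;
   this is a modal condition.  Given p, q and r = H(v), the neighbour w recovers the
   state of v as that of any of its own neighbours with hash r (v is one of them,
   edges being symmetric).  As p must be bounded by a polynomial, one needs a prime
   between T and 8 T^2, which comes from the central binomial coefficient. *)

Set Implicit Arguments.
Unset Strict Implicit.
Unset Printing Implicit Defensive.

(** * A prime between T and 8 T^2 *)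

Lemma count_index_iota_le m n t : \sum_(m <= j < n) (0 < j <= t) <= t.
Proof.
rewrite -big_mkcond /= sum1_count -size_filter.
rewrite -[leqRHS](size_iota 1).
apply: uniq_leq_size; first by rewrite filter_uniq ?iota_uniq.
by move=> j; rewrite mem_filter mem_iota => /andP[? _]; lia.
Qed.

(** By Legendre's formula the exponent of [p] is the sum over [j] of
    [k.*2 %/ p ^ j - 2 * (k %/ p ^ j)]. Each term is at most 1 and vanishes once [p ^ j > k.*2], so
    the exponent is at most the logarithm of [k.*2] in base [p]. *)
Lemma central_bin_pfactor_le p k :
  prime p -> 0 < k -> p ^ logn p 'C(k.*2, k) <= k.*2.
Proof.
move=> p_pr k_gt0; have p_gt1 := prime_gt1 p_pr.
have k2_gt0 : 0 < k.*2 by rewrite double_gt0.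
apply: leq_trans (trunc_logP p_gt1 k2_gt0).
rewrite leq_exp2l //; set t := trunc_log p _.
have le_k2k : k <= k.*2 by rewrite -addnn leq_addl.
have := congr1 (logn p) (bin_fact le_k2k).
rewrite -addnn addnK addnn !lognM ?muln_gt0 ?fact_gt0 ?bin_gt0 //.
rewrite !logn_fact //.
rewrite (big_cat_nat (n := k.+1) (p := k.*2.+1)) //=.
set A := \sum_(1 <= j < k.+1) k %/ p ^ j => eqC.
(* The sum for the factorial of [k] is padded with zero terms, so that both sides can be compared
   term by term. *)
have {}eqC : logn p 'C(k.*2, k) + \sum_(1 <= j < k.*2.+1) (k %/ p ^ j).*2
    = \sum_(1 <= j < k.*2.+1) k.*2 %/ p ^ j.
  rewrite [RHS](big_cat_nat (n := k.+1)) //= -eqC; congr (_ + _).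
  rewrite (big_cat_nat (n := k.+1)) //= [X in _ + X = _]big_nat_cond.
  rewrite [X in _ + X = _]big1 => [|j].
    rewrite addn0 addnn -mul2n /A big_distrr /=.
    by apply: eq_bigr => j _; rewrite mul2n.
  case/andP=> /andP[ltkj _] _; rewrite divn_small //.
  by apply: (leq_trans ltkj); apply: ltnW; apply: ltn_expl.
have le_t : \sum_(1 <= j < k.*2.+1) (p ^ j <= k.*2) <= t.
  apply: leq_trans (count_index_iota_le 1 k.*2.+1 t).
  rewrite big_nat_cond [leqRHS]big_nat_cond.
  apply: leq_sum => j /andP[/andP[-> _] _].
  by case: (leqP (p ^ j) k.*2) => // le2k; rewrite (trunc_log_max p_gt1 le2k).
rewrite -(leq_add2r (\sum_(1 <= j < k.*2.+1) (k %/ p ^ j).*2)) eqC.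
apply: leq_trans (leq_add le_t (leqnn _)).
rewrite -big_split /=; apply: leq_sum => j _.
have pj_gt0 : 0 < p ^ j by rewrite expn_gt0 (ltnW p_gt1).
case: (leqP (p ^ j) k.*2) => [_|lt2k]; last by rewrite divn_small.
rewrite -ltnS ltn_divLR // {1}(divn_eq k (p ^ j)).
have := ltn_pmod k pj_gt0; nia.
Qed.

Lemma central_bin_ge k : 2 ^ k <= 'C(k.*2, k).
Proof.
elim: k => // k IHk; have lt_k1 : k.+1 <= k.*2.+1 by lia.
have := mul_bin_diag k.+1.*2 k; rewrite doubleS [_.-1]/= => e.
have {e} e2 : 'C(k.*2.+2, k.+1) = 2 * 'C(k.*2.+1, k) by nia.
rewrite e2 expnS leq_mul2l /=; apply: (leq_trans IHk).
by case: k {IHk lt_k1 e2} => // k; rewrite binS leq_addr.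
Qed.

(** Let [k = 4 * T ^ 2]. Without primes above [T] and up to [2k], the central binomial coefficient
    is a product of at most [T] prime powers, each at most [2k], whence [2 ^ k <= (2k) ^ T]. But
    [2 ^ k] is the [T]-th power of [2 ^ (4 * T)], which exceeds [2k = 8 * T ^ 2]. *)
Lemma prime_between T : 1 < T -> exists p, [/\ prime p, T < p & p <= 8 * T ^ 2].
Proof.
move=> T_gt1; set k := 4 * T ^ 2; have k_gt0 : 0 < k by rewrite /k; nia.
have k2E : 8 * T ^ 2 = k.*2 by rewrite /k; lia.
have [/existsP[i /andP[i_pr ltTi]]|noP] :=
    boolP [exists i : 'I_(k.*2).+1, prime i && (T < i)].
  by exists i; split=> //; rewrite k2E -ltnS.
suff : 'C(k.*2, k) <= k.*2 ^ T.
  move=> /(leq_trans (central_bin_ge k)); rewrite leqNgt => /negP[].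
  have -> : 2 ^ k = (2 ^ (4 * T)) ^ T by rewrite -expnM /k; congr (_ ^ _); nia.
  rewrite ltn_exp2r ?(ltnW T_gt1) // /k expnM -mul2n.
  have : T.+1 <= 2 ^ T by apply: ltn_expl.
  have -> : (2 ^ 4) ^ T = (2 ^ T) ^ 4 by rewrite -!expnM mulnC.
  move: (2 ^ T) => x le_x; rewrite (_ : x ^ 4 = x ^ 2 * x ^ 2); last by rewrite -expnD.
  have : 3 ^ 2 <= x ^ 2 by rewrite leq_exp2r //; lia.
  have : T ^ 2 < x ^ 2 by rewrite ltn_exp2r.
  by move: (T ^ 2) (x ^ 2) => a b; nia.
have C_gt0 : 0 < 'C(k.*2, k) by rewrite bin_gt0; lia.
rewrite -{1}(partnT C_gt0) /partn big_mkcond /=.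
set n := 'C(_, _).+1.
apply: leq_trans (_ : \prod_(0 <= p < n) k.*2 ^ (0 < p <= T) <= _); last first.
  by rewrite -expn_sum leq_pexp2l ?count_index_iota_le //; lia.
rewrite !big_mkord.
elim/big_ind2: _ => [//|a1 a2 b1 b2|p _]; first exact: leq_mul.
have [p_pr|p_npr] := boolP (prime p); last first.
  by rewrite lognE (negPf p_npr) expn_gt0; lia.
have le_pow := central_bin_pfactor_le p_pr k_gt0; rewrite prime_gt0 //=.
rewrite -[leqLHS]/(p ^ _).
have [//|ltTp] := leqP p T.
have [lepk|ltkp] := leqP p k.*2.
  case/existsP: noP; exists (Ordinal (lepk : p < (k.*2).+1)) => /=.
  by rewrite p_pr.
case e: (logn p _) => [|a] //; apply: contraTT ltkp => _; rewrite -leqNgt.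
by apply: leq_trans le_pow; rewrite -[leqLHS]expn1 e leq_exp2l // prime_gt1.
Qed.

(** * Hashing by sums of inverses modulo a prime *)

Section ModularHash.
Import GRing.Theory.

(** For a prime [p] not dividing [a], only the inverse of [a] contributes; the quotient [k] is at
    most [a] because [z < p]. This form uses only sums, products and comparisons, the operations
    that expressions have. *)
Definition modinv (p a : nat) : nat :=
  \sum_(z < p) z * (0 < \sum_(k < a.+1) (z * a == 1 + k * p)).

Lemma Fp_natr_inj p : prime p -> {in gtn p &, injective (fun n => n%:R : 'F_p)%R}.
Proof.
move=> p_pr m n; rewrite !inE => ltmp ltnp /(congr1 val) /=.
by rewrite !val_Fp_nat // !modn_small.
Qed.

Lemma modinvM p a : prime p -> ~~ (p %| a) ->
  ((modinv p a)%:R * a%:R = 1 :> 'F_p)%R.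
Proof.
move=> p_pr pNa; have p_gt1 := prime_gt1 p_pr.
have a_neq0 : (a%:R != 0 :> 'F_p)%R by rewrite -(dvdn_pcharf (pchar_Fp p_pr)).
have indE (z : 'I_p) : (0 < \sum_(k < a.+1) (z * a == 1 + k * p))
    = (z%:R == a%:R^-1 :> 'F_p)%R.
  rewrite lt0n sum_nat_eq0 negb_forall; apply/existsP/eqP => [[k]|zE].
    rewrite eqb0 negbK => /eqP/(congr1 (fun n => n%:R : 'F_p)%R).
    rewrite natrD !natrM (eqP (_ : p%:R == 0)%R) ?mulr0 ?addr0 => [e|].
      by rewrite -[LHS](mulfK a_neq0) e mul1r.
    by rewrite -(dvdn_pcharf (pchar_Fp p_pr)).
  have ltk : z * a %/ p < a.+1.
    by rewrite ltn_divLR ?prime_gt0 //; have := ltn_ord z; nia.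
  exists (Ordinal ltk) => /=; rewrite eqb0 negbK addnC {1}(divn_eq (z * a) p).
  rewrite eqn_add2l -(val_Fp_nat p_pr) natrM zE mulVf //.
have [z0 z0E] : exists z0 : 'I_p, (z0%:R = a%:R^-1 :> 'F_p)%R.
  have lt_z : (a%:R^-1 : 'F_p)%R < p by rewrite -[ltnRHS](Fp_cast p_pr) ltn_ord.
  by exists (Ordinal lt_z) => /=; rewrite natr_Zp.
rewrite /modinv (bigD1 z0) //= indE z0E eqxx muln1 big1 ?addn0 ?z0E ?mulVf //.
move=> z neq_z; rewrite indE -z0E; case: eqP => [|_]; last by rewrite muln0.
move/(Fp_natr_inj p_pr); rewrite !inE => /(_ (ltn_ord _) (ltn_ord _)) /val_inj e.
by rewrite e eqxx in neq_z.
Qed.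

Section CauchyHash.
Variables (I : finType) (L p : nat) (s : I -> nat -> nat).
Hypotheses (p_pr : prime p) (s_lt : forall u i, i < L -> s u i < p).
Hypothesis p_gt : #|I| ^ 2 * L + L < p.
Local Open Scope ring_scope.

Let dif (uv : I * I) (i : 'I_L) : 'F_p := (s uv.1 i)%:R - (s uv.2 i)%:R.
Let lin (i : nat) : {poly 'F_p} := 'X + (i%:R)%:P.
(** The numerator of the rational function [\sum_i dif uv i / ('X + i)] over the common denominator
    [\prod_i lin i]. *)
Let num (uv : I * I) : {poly 'F_p} :=
  \sum_(i < L) dif uv i *: \prod_(j < L | j != i) lin j.

Lemma lin_size i : size (lin i) = 2%N.
Proof. by rewrite size_XaddC. Qed.

Lemma lin_neq0 i : lin i != 0.
Proof. by rewrite -size_poly_gt0 lin_size. Qed.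

Lemma size_num uv : (size (num uv) <= L)%N.
Proof.
apply: leq_trans (size_sum _ _ _) _; apply/bigmax_leqP => i _.
apply: leq_trans (size_scale_leq _ _) _.
rewrite size_prod => [|j _]; last exact: lin_neq0.
under eq_bigr do rewrite lin_size.
rewrite sum_nat_const -[#|_|]/#|predC1 i| cardC1 card_ord.
have := ltn_ord i; lia.
Qed.

(** At [- i] only the [i]-th summand survives, and its cofactor, the product of the [j - i], is
    nonzero because [L < p]. *)
Lemma num_eq0 uv : num uv = 0 -> forall i, (i < L)%N -> s uv.1 i = s uv.2 i.
Proof.
move=> num0 i ltiL; set i0 := Ordinal ltiL.
have := congr1 (fun P => P.[- i%:R]) num0; rewrite horner0 horner_sum.
rewrite (bigD1 i0) //= [X in _ + X]big1 => [|j neq_j]; last first.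
  by rewrite hornerZ horner_prod (bigD1 i0) 1?eq_sym //=;
    rewrite hornerD hornerX hornerC addNr mul0r mulr0.
rewrite addr0 hornerZ horner_prod => /eqP; rewrite mulf_eq0 => /orP[|/eqP].
  rewrite subr_eq0 => /eqP; apply: Fp_natr_inj => //; rewrite inE; exact: s_lt.
move/eqP/prodf_eq0 => [j neq_j]; rewrite !hornerE addrC subr_eq0 => /eqP eq_ij.
case/negP: neq_j; apply/eqP/val_inj => /=.
have ltLp : (L < p)%N by lia.
by apply: (Fp_natr_inj p_pr) => //; rewrite inE (ltn_trans _ ltLp) ?ltn_ord.
Qed.

Lemma cauchy_hash : exists2 q, (q < p)%N & forall u v,
  (\sum_(i < L) s u i * modinv p (q + i) = \sum_(i < L) s v i * modinv p (q + i))%N ->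
  forall i, (i < L)%N -> s u i = s v i.
Proof.
(* A non-root [q] of [R] makes every [q + i] invertible, by the first factor, and is no zero of a
   nonzero numerator, by the second. As [R] has degree below [p], the field contains such a [q]. *)
pose R := (\prod_(i < L) lin i) * \prod_(uv | num uv != 0) num uv.
have P1_neq0 : \prod_(i < L) lin i != 0 by apply/prodf_neq0 => i _; apply: lin_neq0.
have P2_neq0 : \prod_(uv | num uv != 0) num uv != 0 by apply/prodf_neq0.
have size_R : (size R <= p)%N.
  rewrite size_mul // !size_prod // => [|i _]; last exact: lin_neq0.
  under eq_bigr do rewrite lin_size.
  have cT : #|(xpredT : pred 'I_L)| = L by rewrite cardT size_enum_ord.
  rewrite sum_nat_const cT.
  have : (\sum_(uv | num uv != 0%R) size (num uv) <= #|I| ^ 2 * L)%N.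
    apply: (@leq_trans (\sum_(uv | num uv != 0%R) L)%N).
      by apply: leq_sum => uv _; apply: size_num.
    rewrite sum_nat_const leq_mul2r (leq_trans (max_card _)) ?orbT //.
    by rewrite card_prod.
  by move: p_gt; set S := bigop _ _ _; set c := #|_|; lia.
have [q Rq] : exists q : 'F_p, ~~ root R q.
  apply/existsP; apply: contraTT size_R => /existsPn rootR.
  rewrite -ltnNge -{1}(card_Fp p_pr) cardE; apply: max_poly_roots.
  - by rewrite mulf_neq0.
  - by apply/allP => q _; have := rootR q; rewrite negbK.
  - exact: enum_uniq.
exists q => [|u v eq_uv].
  by rewrite -[ltnRHS](Fp_cast p_pr) ltn_ord.
move: Rq; rewrite rootM negb_or => /andP[Rq1 Rq2].
have qi_neq0 (i : 'I_L) : q + i%:R != 0.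
  move: Rq1; apply: contra => /eqP qi0.
  by rewrite /root horner_prod (bigD1 i) //= !hornerE qi0 mul0r.
apply: (@num_eq0 (u, v)); apply/eqP; apply: contraNT Rq2 => nz.
rewrite /root horner_prod (bigD1 (u, v)) //=.
suff -> : (num (u, v)).[q] = 0 by rewrite mul0r.
(* All [q + i] being invertible, the numerator at [q] is [Q] times the difference of the two
   hashes. *)
pose Q := \prod_(i < L) (q + i%:R).
have -> : (num (u, v)).[q] = Q * \sum_(i < L) dif (u, v) i * (modinv p (q + i))%:R.
  rewrite horner_sum mulr_sumr; apply: eq_bigr => i _.
  rewrite hornerZ horner_prod mulrCA; congr (_ * _).
  rewrite /Q [in RHS](bigD1 i) //= mulrAC.
  have := @modinvM p (q + i)%N p_pr; rewrite natrD natr_Zp => e.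
  rewrite [X in X * _](mulrC) e ?mul1r.
    by apply: eq_bigr => j _; rewrite !hornerE.
  by rewrite (dvdn_pcharf (pchar_Fp p_pr)) natrD natr_Zp.
rewrite (eq_bigr _ (fun i _ => mulrBl _ _ _)) sumrB.
under eq_bigr do rewrite -natrM.
under [X in _ - X]eq_bigr do rewrite -natrM.
by rewrite -!natr_sum eq_uv subrr mulr0.
Qed.
End CauchyHash.
End ModularHash.

(** * Numerical expressions *)

(* Expressions denote numbers (Booleans being 0 and 1) at a pair (u, v) of vertices of
   which v is the current one: [ESwap] exchanges them, and [ENb a] sums [a] over the
   pairs (v, w) with w a neighbour of v.  All expressions together correspond to the
   guarded fragment, those without [ESwap] to the modal one. *)
Inductive expr (l : nat) : Type :=
| EVar of nat
| ECst of nat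
| EOrd
| ELab of 'I_l
| EAdd of expr l & expr l
| EMul of expr l & expr l
| ELe of expr l & expr l
| ESum of nat & expr l & expr l
| ENb of expr l
| ESwap of expr l.
Arguments EVar {l}.
Arguments ECst {l}.
Arguments EOrd {l}.

Definition upd (na : nat -> nat) (y i : nat) : nat -> nat :=
  fun z => if z == y then i else na z.

Lemma upd_eq na y i : upd na y i y = i.
Proof. by rewrite /upd eqxx. Qed.

Lemma upd_neq na y i z : z != y -> upd na y i z = na z.
Proof. by rewrite /upd => /negPf->. Qed.

Section Expressions.
Variable l : nat.
Implicit Types (G : lgraph l) (e a m : expr l) (na : nat -> nat).

Fixpoint eval G (u v : G) na e : nat :=
  match e with
  | EVar y => na y
  | ECst n => n
  | EOrd => #|G|
  | ELab i => v \in label G i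
  | EAdd a b => eval u v na a + eval u v na b
  | EMul a b => eval u v na a * eval u v na b
  | ELe a b => eval u v na a <= eval u v na b
  | ESum y a b => \sum_(i < eval u v na a) eval u v (upd na y i) b
  | ENb a => \sum_(w | edge v w) eval v w na a
  | ESwap a => eval v u na a
  end.

(* Bound variables count as well, so that names from [var_bound e] on cannot be
   captured in [e]. *)
Fixpoint var_bound e : nat :=
  match e with
  | EVar y => y.+1
  | ECst _ | EOrd | ELab _ => 0
  | EAdd a b | EMul a b | ELe a b => maxn (var_bound a) (var_bound b)
  | ESum y a b => maxn y.+1 (maxn (var_bound a) (var_bound b))
  | ENb a | ESwap a => var_bound a
  end.

Fixpoint modal e : bool :=
  match e with
  | EVar _ | ECst _ | EOrd | ELab _ => true
  | EAdd a b | EMul a b | ELe a b | ESum _ a b => modal a && modal b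
  | ENb a => modal a
  | ESwap _ => false
  end.

Lemma eval_agree e G (u v : G) na na' :
  (forall z, z < var_bound e -> na z = na' z) -> eval u v na e = eval u v na' e.
Proof.
elim: e u v na na' => //=.
- by move=> y u v na na'; apply.
- move=> a IHa b IHb u v na na' eq_na; rewrite (IHa _ _ _ na') ?(IHb _ _ _ na') //;
  by move=> z ltz; apply: eq_na; lia.
- move=> a IHa b IHb u v na na' eq_na; rewrite (IHa _ _ _ na') ?(IHb _ _ _ na') //;
  by move=> z ltz; apply: eq_na; lia.
- move=> a IHa b IHb u v na na' eq_na; rewrite (IHa _ _ _ na') ?(IHb _ _ _ na') //;
  by move=> z ltz; apply: eq_na; lia.
- move=> y a IHa b IHb u v na na' eq_na.
  rewrite (IHa _ _ _ na') => [|z ltz]; last by apply: eq_na; lia.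
  apply: eq_bigr => i _; apply: IHb => z ltz.
  by rewrite /upd; case: eqP => // _; apply: eq_na; lia.
- by move=> a IHa u v na na' eq_na; apply: eq_bigr => w _; apply: IHa.
- by move=> a IHa u v na na' eq_na; apply: IHa.
Qed.

Lemma eval_ext e G (u v : G) na na' : na =1 na' -> eval u v na e = eval u v na' e.
Proof. by move=> eq_na; apply: eval_agree. Qed.

Lemma eval_modal e G (u u' v : G) na : modal e -> eval u v na e = eval u' v na e.
Proof.
elim: e u u' v na => //=.
- by move=> a IHa b IHb u u' v na /andP[ma mb]; rewrite (IHa _ u') ?(IHb _ u').
- by move=> a IHa b IHb u u' v na /andP[ma mb]; rewrite (IHa _ u') ?(IHb _ u').
- by move=> a IHa b IHb u u' v na /andP[ma mb]; rewrite (IHa _ u') ?(IHb _ u').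
- move=> y a IHa b IHb u u' v na /andP[ma mb]; rewrite (IHa _ u') //.
  by apply: eq_bigr => i _; apply: IHb.
Qed.

(* Only [i = a] survives in the sum over [i <= a]: expressions have no binder other
   than sums. *)
Definition ELet y a e := ESum y (EAdd a (ECst 1)) (EMul (ELe a (EVar y)) e).
Definition EEq a b := EMul (ELe a b) (ELe b a).
Definition ELt a b := ELe (EAdd a (ECst 1)) b.
Definition ENot a := ELe a (ECst 0).
Fixpoint EPow a n := if n is n'.+1 then EMul a (EPow a n') else ECst 1.

(* The number of [y' < a] such that [e] vanishes for all [y <= y'] is the least [y < a]
   at which [e] does not vanish. *)
Definition EFirst y y' a e :=
  ESum y' a (ENot (ESum y (EAdd (EVar y') (ECst 1)) e)).

Section Eval.
Variables (G : lgraph l) (u v : G).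

Lemma eval_ELet y a e na : var_bound a <= y ->
  eval u v na (ELet y a e) = eval u v (upd na y (eval u v na a)) e.
Proof.
move=> le_y; rewrite /= addn1.
have eq_a i : eval u v (upd na y i) a = eval u v na a.
  by apply: eval_agree => z ltz; rewrite upd_neq //; lia.
rewrite big_ord_recr /= upd_eq eq_a leqnn mul1n big1 // => i _.
by rewrite upd_eq eq_a leqNgt ltn_ord.
Qed.

Lemma eval_ELt a b na : eval u v na (ELt a b) = (eval u v na a < eval u v na b).
Proof. by rewrite /= addn1. Qed.

Lemma eval_ENot a na : eval u v na (ENot a) = (eval u v na a == 0).
Proof. by rewrite /= leqn0. Qed.

Lemma eval_EPow a n na : eval u v na (EPow a n) = eval u v na a ^ n.
Proof. by elim: n => //= n ->; rewrite expnS. Qed.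

(** Several constructions present a number as the count of the indices below it; this recovers the
    number. *)
Lemma sum_ltn_ord n k : \sum_(i < n) (i < k) = minn n k.
Proof.
elim: n => [|n IHn]; first by rewrite big_ord0 min0n.
by rewrite big_ord_recr /= IHn; lia.
Qed.

Lemma eval_EFirst y y' a e na : var_bound e <= y' -> y != y' ->
  (exists2 i, i < eval u v na a & eval u v (upd na y i) e != 0) ->
  let i := eval u v na (EFirst y y' a e) in
  i < eval u v na a /\ eval u v (upd na y i) e != 0.
Proof.
move=> le_y' neq_y /=; set f := fun i => eval u v (upd na y i) e => exf.
have evE j : (\sum_(i < upd na y' j y' + 1) eval u v (upd (upd na y' j) y i) e <= 0)
    = [forall i : 'I_j.+1, f i == 0].
  rewrite leqn0 sum_nat_eq0 upd_eq addn1; apply: eq_forallb => i /=.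
  rewrite /f; congr (_ == _); apply: eval_agree => z ltz.
  by rewrite /upd; do 2!case: eqP => //; lia.
under eq_bigr do rewrite evE.
have exf' : exists i, (i < eval u v na a) && (f i != 0).
  by case: exf => i lti fi; exists i; rewrite lti.
case: (ex_minnP exf') => k /andP[ltk fk] min_k.
suff -> : \sum_(j < eval u v na a) [forall i : 'I_j.+1, f i == 0] = k by [].
rewrite -[RHS](minn_idPr (ltnW ltk)) -sum_ltn_ord; apply: eq_bigr => j _.
congr nat_of_bool; apply/forallP/idP => [fj|ltjk i].
  rewrite ltnNge; apply: contra fk => lekj.
  by have := fj (Ordinal (lekj : k < j.+1)).
apply: contraLR ltjk => fi; rewrite -leqNgt.
have := min_k i; rewrite fi andbT => /(_ _)/leq_trans; apply.
  by have := ltn_ord i; have := ltn_ord j; lia.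
by rewrite -ltnS.
Qed.
End Eval.

(* [box K b e] sums [e] over all values below [b] of the variables [0, ..., K - 1], which
   are the digits in base [b] of a number below [b ^ K]. *)
Fixpoint box K b e : expr l := if K is K'.+1 then box K' b (ESum K' b e) else e.
Fixpoint encodeE K b : expr l :=
  if K is K'.+1 then EAdd (EMul (encodeE K' b) b) (EVar K') else ECst 0.
Fixpoint encode K b na : nat := if K is K'.+1 then encode K' b na * b + na K' else 0.
Fixpoint decode K b na j : nat -> nat :=
  if K is K'.+1 then upd (decode K' b na (j %/ b)) K' (j %% b) else na.

Lemma decode_ge K b na j z : K <= z -> decode K b na j z = na z.
Proof.
elim: K j => //= K IHK j ltz; rewrite upd_neq ?IHK //; lia.
Qed.

Lemma decode_lt K b na j z : 0 < b -> z < K -> decode K b na j z < b.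
Proof.
move=> b_gt0; elim: K j => //= K IHK j ltz; rewrite /upd.
by case: eqP => [_|?]; [rewrite ltn_pmod | apply: IHK; lia].
Qed.

Lemma decode_base K b na na' j z : z < K -> decode K b na j z = decode K b na' j z.
Proof.
by elim: K j => //= K IHK j ltz; rewrite /upd; case: eqP => // ?; apply: IHK; lia.
Qed.

Lemma encode_agree K b na na' : (forall z, z < K -> na z = na' z) ->
  encode K b na = encode K b na'.
Proof.
by elim: K => //= K IHK eq_na; rewrite IHK ?eq_na // => z ltz; apply: eq_na; lia.
Qed.

Lemma encodeK K b na j : j < b ^ K -> encode K b (decode K b na j) = j.
Proof.
elim: K j => [[]|K IHK] //= j ltj.
have b_gt0 : 0 < b by case: b ltj {IHK} => //; rewrite exp0n.
rewrite upd_eq (@encode_agree _ _ _ (decode K b na (j %/ b))) => [|z ltz]; last first.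
  by rewrite upd_neq //; lia.
by rewrite IHK -?divn_eq // ltn_divLR // mulnC -expnS.
Qed.

Lemma decodeK K b na na' z : (forall z, z < K -> na z < b) -> z < K ->
  decode K b na' (encode K b na) z = na z.
Proof.
elim: K => //= K IHK lt_na ltz.
have ltK : na K < b by apply: lt_na.
rewrite /upd; case: eqP => [->|neq_z].
  by rewrite modnMDl modn_small.
rewrite divnMDl ?divn_small ?addn0 ?IHK //; last by [lia].
- by move=> z' ltz'; apply: lt_na; lia.
- by lia.
Qed.

Lemma encode_lt K b na : (forall z, z < K -> na z < b) -> encode K b na < b ^ K.
Proof.
elim: K => //= K IHK lt_na; have ltK : na K < b by apply: lt_na.
have : encode K b na < b ^ K by apply: IHK => z ltz; apply: lt_na; lia.
rewrite expnS; move: (b ^ K) => B; nia.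
Qed.

Lemma eval_encodeE K b G (u v : G) na : eval u v na (encodeE K (EVar b)) = encode K (na b) na.
Proof. by elim: K => //= K ->. Qed.

Lemma sum_divmod b n (F : nat -> nat -> nat) :
  \sum_(i < n) \sum_(c < b) F i c = \sum_(j < n * b) F (j %/ b) (j %% b).
Proof.
elim: n => [|n IHn]; first by rewrite !big_ord0.
rewrite big_ord_recr /= IHn mulSn [in RHS]addnC big_split_ord /=.
congr (_ + _); apply: eq_bigr => i _.
by rewrite divnMDl ?modnMDl ?divn_small ?modn_small ?addn0 //; case: i => i /=; lia.
Qed.

Lemma eval_box K c e G (u v : G) na : K <= c ->
  eval u v na (box K (EVar c) e)
    = \sum_(j < na c ^ K) eval u v (decode K (na c) na j) e.
Proof.
elim: K e => [|K IHK] e ltKc; first by rewrite expn0 big_ord1.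
rewrite /= IHK; last by lia.
rewrite expnSr -(sum_divmod _ _ (fun i d => eval u v (upd (decode K (na c) na i) K d) e)).
by apply: eq_bigr => j _ /=; rewrite decode_ge // ltnW.
Qed.

End Expressions.

Ltac upd_simp := rewrite /upd ?eqxx;
  repeat match goal with |- context [?a == ?b :> nat] =>
    rewrite (_ : (a == b) = false); [|lia] end.

(** * Looking up a value by its hash *)

Section Elimination.
Variable l : nat.
Implicit Types (G : lgraph l) (e a m : expr l) (na : nat -> nat).

(* [eval_le_expn]: if all variables and the order of the graph are at most [x >= 2], then
   [e] is at most [x ^ degree e]. *)
Fixpoint degree e : nat :=
  match e with
  | ECst n => n.+1
  | EVar _ | EOrd | ELab _ => 1
  | EAdd a b | EMul a b | ELe a b => degree a + degree b
  | ESum _ a b => degree a * (degree b).+1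
  | ENb a => (degree a).+1
  | ESwap a => degree a
  end.

Lemma degree_gt0 e : 0 < degree e.
Proof. by elim: e => //= *; rewrite ?addn_gt0 ?muln_gt0; apply/orP || apply/andP; auto. Qed.

Lemma eval_le_expn e K x G (u v : G) na : 1 < x -> #|G| <= x ->
  var_bound e <= K -> (forall z, z < K -> na z <= x) -> eval u v na e <= x ^ degree e.
Proof.
elim: e x u v na => [y|n||i|a IHa b IHb|a IHa b IHb|a IHa b IHb|y a IHa b IHb|a IHa|a IHa] /=
  x u v na x_gt1 leGx le_vb le_na.
- by rewrite expn1 le_na.
- by apply: leq_trans (ltnW (ltn_expl n.+1 x_gt1)).
- by rewrite expn1.
- by rewrite expn1; case: (_ \in _); lia.
- have {}IHa := IHa x u v na x_gt1 leGx (leq_trans (leq_maxl _ _) le_vb) le_na.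
  have {}IHb := IHb x u v na x_gt1 leGx (leq_trans (leq_maxr _ _) le_vb) le_na.
  have : x ^ 1 <= x ^ degree a by rewrite leq_pexp2l ?degree_gt0 // ltnW.
  have : x ^ 1 <= x ^ degree b by rewrite leq_pexp2l ?degree_gt0 // ltnW.
  by rewrite expnD; nia.
- have {}IHa := IHa x u v na x_gt1 leGx (leq_trans (leq_maxl _ _) le_vb) le_na.
  have {}IHb := IHb x u v na x_gt1 leGx (leq_trans (leq_maxr _ _) le_vb) le_na.
  by rewrite expnD leq_mul.
- by apply: leq_trans (leq_b1 _) _; rewrite expn_gt0 ltnW.
- have {}IHa : eval u v na a <= x ^ degree a by apply: IHa => //; lia.
  have lexx : x <= x ^ degree a by rewrite -{1}[x]expn1 leq_pexp2l ?degree_gt0 // ltnW.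
  rewrite mulnS expnD expnM.
  apply: leq_trans (_ : eval u v na a * (x ^ degree a) ^ degree b <= _); last first.
    by rewrite leq_mul2r IHa orbT.
  rewrite -[X in X * _]card_ord -sum_nat_const; apply: leq_sum => i _.
  apply: IHb; [lia | exact: leq_trans lexx | lia | move=> z ltz].
  rewrite /upd; case: eqP => _; last by apply: leq_trans lexx; apply: le_na.
  by apply: leq_trans IHa; apply: ltnW.
- rewrite expnS; apply: leq_trans (_ : #|G| * x ^ degree a <= _); last first.
    by rewrite leq_mul2r leGx orbT.
  apply: (@leq_trans (\sum_(w | edge v w) x ^ degree a)).
    by apply: leq_sum => w _; apply: IHa.
  by rewrite sum_nat_const leq_mul2r max_card orbT.
- exact: IHa.
Qed.

(* From here on, [K] bounds the variables of the expressions to be hashed and is itself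
   the name of the variable holding the common bound of their values; [p], [q] and [r]
   name the variables holding modulus, shift and hash, and the names from [k] on are
   auxiliary. *)
Definition modinvE K k p q : expr l :=
  let i := EAdd (EVar q) (encodeE K (EVar K)) in
  ESum k (EVar p) (EMul (EVar k)
    (ELt (ECst 0) (ESum k.+1 (EAdd i (ECst 1))
      (EEq (EMul (EVar k) i) (EAdd (ECst 1) (EMul (EVar k.+1) (EVar p))))))).

Lemma eval_modinvE K k p q G (u v : G) na : K < k -> k.+1 < p -> k.+1 < q ->
  eval u v na (modinvE K k p q) = modinv (na p) (na q + encode K (na K) na).
Proof.
move=> ltKk ltkp ltkq; rewrite /modinvE /modinv /=.
apply: eq_bigr => z _; rewrite upd_eq add0n; congr (_ * (0 < _)).
set na1 := upd na k z.
have idxK na' : (forall y, y <= K -> na' y = na y) ->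
    eval u v na' (encodeE K (EVar K)) = encode K (na K) na.
  move=> eq_na; rewrite eval_encodeE eq_na //; apply: encode_agree => y lty.
  by rewrite eq_na // ltnW.
rewrite idxK => [|y ley]; last by rewrite /na1 upd_neq //; lia.
have -> : na1 q = na q by rewrite /na1; upd_simp.
rewrite addn1; apply: eq_bigr => j _.
rewrite mulnb -eqn_leq idxK => [|y ley]; last by rewrite /na1 !upd_neq //; lia.
by rewrite /na1; upd_simp.
Qed.

Definition hashE K k p q m := box K (EVar K) (EMul m (modinvE K k p q)).

(** The letter at position [j] of the string of [u]: the digits of a position in base [b] are an
    assignment to the variables below [K]. A modal [m] reads only the second vertex, so [u] fills
    both places. *)
Definition mval K b m G (u : G) j := eval u u (decode K b (fun=> 0) j) m.

Definition hashv K b p q m G (u : G) :=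
  \sum_(j < b ^ K) mval K b m u j * modinv p (q + j).

Lemma eval_mval K b j m G (u v : G) na : modal m -> var_bound m <= K ->
  (forall z, z < K -> na z = decode K b (fun=> 0) j z) -> eval u v na m = mval K b m v j.
Proof.
move=> mod_m le_m eq_na; rewrite (eval_modal _ v) //; apply: eval_agree => z ltz.
by apply: eq_na; apply: leq_trans le_m.
Qed.

Lemma eval_hashE K k p q m G (u v : G) na :
  modal m -> var_bound m <= K -> K < k -> k.+1 < p -> k.+1 < q ->
  eval u v na (hashE K k p q m) = hashv K (na K) (na p) (na q) m v.
Proof.
move=> mod_m le_m ltKk ltkp ltkq; rewrite eval_box //; apply: eq_bigr => j _.
rewrite -[LHS]/(eval _ _ _ m * eval _ _ _ (modinvE K k p q)) eval_modinvE //.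
rewrite !decode_ge; try lia; rewrite encodeK //; congr (_ * _).
by apply: eval_mval => // z; apply: decode_base.
Qed.

Definition separates K b p q m G (v : G) : Prop :=
  forall w u : G, edge v w -> edge w u ->
  hashv K b p q m u = hashv K b p q m v ->
  forall j, j < b ^ K -> mval K b m u j = mval K b m v j.

(** A modal expression cannot look back at [v], so the hash of [v] and its letter at the current
    position are stored in [r] and [k.+2] before the two steps to neighbours. The sum over all
    positions counts violations. *)
Definition separatesE K k p q r m :=
  ELet r (hashE K k p q m) (ENot (box K (EVar K)
    (ELet k.+2 m (ENb (ENb (EMul (EEq (hashE K k p q m) (EVar r))
      (ENot (EEq m (EVar k.+2))))))))).

Lemma var_bound_box K c e n : K <= n -> c < n -> var_bound e <= n ->
  var_bound (box K (EVar c) e) <= n.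
Proof.
move=> + ltcn; elim: K e => //= K IHK e ltKn le_e.
by apply: IHK; rewrite /= ?geq_max ?ltKn ?ltcn //; lia.
Qed.

Lemma var_bound_encodeE K c n : K <= n -> c < n ->
  var_bound (encodeE K (EVar c) : expr l) <= n.
Proof.
by move=> + ltcn; elim: K => //= K IHK ltKn; rewrite !geq_max ltcn ltKn IHK //; lia.
Qed.

Lemma var_bound_hashE K k p q m n :
  var_bound m <= K -> K < k -> k.+1 < n -> p < n -> q < n ->
  var_bound (hashE K k p q m) <= n.
Proof.
move=> le_m ltKk ltkn ltpn ltqn; apply: var_bound_box => /=; [lia | lia |].
have := @var_bound_encodeE K K n; move: (var_bound (encodeE _ _)) => a le_a.
by rewrite !geq_max; do !(apply/andP; split) => //; try apply: le_a; lia.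
Qed.

Lemma var_bound_separatesE K k p q r m n :
  var_bound m <= K -> K < k -> k.+2 < n -> p < n -> q < n -> r < n ->
  var_bound (separatesE K k p q r m) <= n.
Proof.
move=> le_m ltKk ltkn ltpn ltqn ltrn.
have le_h : var_bound (hashE K k p q m) <= n by apply: var_bound_hashE; lia.
rewrite /separatesE /ELet /ENot /EEq /= !geq_max le_h ltrn /= andbT.
by apply: var_bound_box => /=; rewrite ?geq_max ?le_h ?ltrn; lia.
Qed.

Lemma eval_separatesE K k p q r m G (u v : G) na :
  modal m -> var_bound m <= K -> K < k -> k.+2 < p -> k.+2 < q -> p < r -> q < r ->
  (eval u v na (separatesE K k p q r m) != 0) <-> separates K (na K) (na p) (na q) m v.
Proof.
move=> mod_m le_m ltKk ltkp ltkq ltpr ltqr.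
have le_h : var_bound (hashE K k p q m) <= r by apply: var_bound_hashE; lia.
rewrite /separatesE eval_ELet; last by lia.
rewrite eval_hashE //; try lia.
set na1 := upd na r _.
rewrite eval_ENot eval_box // eqb0 negbK sum_nat_eq0.
have na1K : na1 K = na K by rewrite /na1; upd_simp.
have evB (j : nat) : (eval u v (decode K (na1 K) na1 j)
    (ELet k.+2 m (ENb (ENb (EMul (EEq (hashE K k p q m) (EVar r))
      (ENot (EEq m (EVar k.+2))))))) == 0)
  = [forall (w : G | edge v w), forall (x : G | edge w x),
       (hashv K (na K) (na p) (na q) m x == hashv K (na K) (na p) (na q) m v)
       ==> (mval K (na K) m x j == mval K (na K) m v j)].
  rewrite eval_ELet; last by lia.
  rewrite [eval _ _ _ (ENb _)]/= sum_nat_eq0; apply: eq_forallb => w; congr (_ ==> _).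
  rewrite sum_nat_eq0; apply: eq_forallb => x; congr (_ ==> _).
  set na2 := upd _ _ _.
  have mE na' (a b : G) : (forall z, z < K -> na' z = decode K (na1 K) na1 j z) ->
      eval a b na' m = mval K (na K) m b j.
    move=> eq_na; apply: eval_mval => // z ltz; rewrite eq_na // na1K.
    exact: decode_base.
  rewrite /= !mulnb -!eqn_leq leqn0 !eqb0 negb_and negbK -implybE.
  rewrite eval_hashE //; try lia.
  rewrite mE => [|z ltz]; last by rewrite /na2 upd_neq //; lia.
  have -> : na2 k.+2 = mval K (na K) m v j by rewrite /na2 upd_eq mE.
  have na2E z : K <= z -> z != k.+2 -> na2 z = na1 z.
    by move=> leKz neq_z; rewrite /na2 upd_neq // decode_ge.
  rewrite !na2E; try lia.
  rewrite [na1 r]upd_eq na1K.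
  by rewrite /na1 !(upd_neq _ _ (_ : _ != r)) //; lia.
split=> [/forallP sepv w x vw wx eq_h j ltj|sepv].
  have ltj' : j < na1 K ^ K by rewrite na1K.
  have := sepv (Ordinal ltj'); rewrite evB => /forall_inP/(_ w vw)/forall_inP/(_ x wx).
  by rewrite eq_h eqxx => /eqP.
apply/forallP => j; rewrite evB; apply/forall_inP => w vw; apply/forall_inP => x wx.
apply/implyP => /eqP eq_h; apply/eqP; apply: (sepv w x vw wx eq_h).
by case: j => j /=; rewrite na1K.
Qed.

(** The neighbours with hash [r] share one value of [m], but summing it over them would multiply it
    by their number. Instead the value is obtained as the number of [i] that it exceeds at some of
    them. *)
Definition lookupE K k p q r m :=
  ESum k.+2 (EVar K) (ELe (ECst 1)
    (ENb (EMul (EEq (hashE K k p q m) (EVar r)) (ELt (EVar k.+2) m)))).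

Lemma eval_lookupE K k p q r m G (u v w : G) na :
  modal m -> var_bound m <= K -> K < k -> k.+2 < p -> k.+2 < q -> k.+2 < r ->
  (forall z, z < K -> na z < na K) -> eval u v na m < na K -> edge v w ->
  separates K (na K) (na p) (na q) m v ->
  na r = hashv K (na K) (na p) (na q) m v ->
  eval v w na (lookupE K k p q r m) = eval w v na m.
Proof.
move=> mod_m le_m ltKk ltkp ltkq ltkr lt_na lt_m vw sepv rE.
have mE (a b : G) na' : (forall z, z < K -> na' z = na z) ->
    eval a b na' m = mval K (na K) m b (encode K (na K) na).
  move=> eq_na; apply: eval_mval => // z ltz.
  by rewrite decodeK // eq_na.
rewrite -[LHS]/(\sum_(i < na K) _).
transitivity (\sum_(i < na K) (i < eval w v na m)); last first.
  rewrite sum_ltn_ord; apply/minn_idPr/ltnW; by rewrite (mE w v na) // -(mE u v na).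
apply: eq_bigr => i _ /=; congr nat_of_bool.
set na1 := upd na k.+2 i.
have na1E z : z != k.+2 -> na1 z = na z by move=> ?; rewrite /na1 upd_neq.
have summandE (x : G) : edge w x ->
  ((eval w x na1 (hashE K k p q m) <= na1 r) * (na1 r <= eval w x na1 (hashE K k p q m))
    * (na1 k.+2 + 1 <= eval w x na1 m))
  = (hashv K (na K) (na p) (na q) m x == na r) && (i < eval w v na m).
  move=> wx; rewrite !mulnb -eqn_leq eval_hashE //; try lia.
  rewrite [na1 k.+2]upd_eq !na1E; try lia.
  rewrite addn1; case: eqP => //= eq_h.
  rewrite !mE => [|//|z ltz]; last by rewrite na1E //; lia.
  by rewrite (sepv _ _ vw wx) ?eq_h // encode_lt.
rewrite (eq_bigr _ summandE); apply/idP/idP => [|lti].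
  by apply: contraTT => /negPf lti; rewrite -leqNgt leqn0 big1 // => x _; rewrite lti andbF.
have wv : edge w v by rewrite edge_sym.
by rewrite (bigD1 v) //= lti rE eqxx.
Qed.

End Elimination.

(** * Replacing the far end of an edge by hashes *)

Section Key.
Variable l : nat.
Implicit Types (G : lgraph l) (e a m : expr l) (na : nat -> nat) (ms : seq (expr l)).

(* Expressions evaluated at an edge (v, w) in which the far end v enters only through
   modal subexpressions, the [leaves]. *)
Fixpoint mix e : bool :=
  match e with
  | EVar _ | ECst _ | EOrd | ELab _ => true
  | EAdd a b | EMul a b | ELe a b | ESum _ a b => mix a && mix b
  | ENb a | ESwap a => modal a
  end.

Fixpoint leaves e : seq (expr l) :=
  match e with
  | EAdd a b | EMul a b | ELe a b | ESum _ a b => leaves a ++ leaves b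
  | ESwap a => [:: a]
  | _ => [::]
  end.

(* Each leaf gets a block of 13 names: 7, 11 and 12 hold its modulus, shift and hash, and
   the others are auxiliary. *)
Fixpoint use_hashes K k e : expr l :=
  match e with
  | EAdd a b => EAdd (use_hashes K k a) (use_hashes K (k + 13 * size (leaves a)) b)
  | EMul a b => EMul (use_hashes K k a) (use_hashes K (k + 13 * size (leaves a)) b)
  | ELe a b => ELe (use_hashes K k a) (use_hashes K (k + 13 * size (leaves a)) b)
  | ESum y a b => ESum y (use_hashes K k a) (use_hashes K (k + 13 * size (leaves a)) b)
  | ESwap m => lookupE K k (k + 7) (k + 11) (k + 12) m
  | _ => e
  end.

Definition hashed K k m G (v : G) na : Prop :=
  separates K (na K) (na (k + 7)) (na (k + 11)) m v /\
  na (k + 12) = hashv K (na K) (na (k + 7)) (na (k + 11)) m v.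

Fixpoint all_hashed K k ms G (v : G) na : Prop :=
  if ms is m :: ms' then hashed K k m v na /\ all_hashed K (k + 13) ms' v na
  else True.

Lemma all_hashed_cat K k ms ms' G (v : G) na : all_hashed K k (ms ++ ms') v na ->
  all_hashed K k ms v na /\ all_hashed K (k + 13 * size ms) ms' v na.
Proof.
elim: ms k => [|m ms IHms] k /=; first by rewrite muln0 addn0.
by case=> ? /IHms[? ?]; rewrite mulnS addnA.
Qed.

(** Sums inside the expression bind names below [K] only, hence leave the stored hashes intact. *)
Lemma all_hashed_agree K k ms G (v : G) na na' : K <= k ->
  (forall z, K <= z -> na' z = na z) ->
  all_hashed K k ms v na -> all_hashed K k ms v na'.
Proof.
move=> leKk eq_na; elim: ms k leKk => //= m ms IHms k leKk [hm /IHms hms].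
split; last by apply: hms; lia.
by rewrite /hashed !eq_na //; lia.
Qed.

(** Here [x] bounds the variables in scope. A variable bound by a sum up to [a] can reach
    [x ^ degree a], so the induction continues with that number in place of [x]; the degree of a sum
    is chosen so that the bound stored in [K] still suffices. *)
Lemma eval_use_hashes e K k x G (v w : G) na :
  mix e -> var_bound e <= K -> K < k -> edge v w -> all_hashed K k (leaves e) v na ->
  1 < x -> #|G| <= x -> (forall z, z < K -> na z <= x) -> x ^ degree e < na K ->
  eval v w na (use_hashes K k e) = eval v w na e.
Proof.
move=> + + + vw; elim: e k x na => //=.
- move=> a IHa b IHb k x na /andP[mixa mixb]; rewrite geq_max => /andP[lea leb] ltK.
  move=> /all_hashed_cat[ha hb] x_gt1 leG lena; rewrite expnD => ltx.
  have xa : 0 < x ^ degree a by rewrite expn_gt0; lia.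
  have xb : 0 < x ^ degree b by rewrite expn_gt0; lia.
  rewrite (IHa _ x) ?(IHb _ x) //; [lia | nia | nia].
- move=> a IHa b IHb k x na /andP[mixa mixb]; rewrite geq_max => /andP[lea leb] ltK.
  move=> /all_hashed_cat[ha hb] x_gt1 leG lena; rewrite expnD => ltx.
  have xa : 0 < x ^ degree a by rewrite expn_gt0; lia.
  have xb : 0 < x ^ degree b by rewrite expn_gt0; lia.
  rewrite (IHa _ x) ?(IHb _ x) //; [lia | nia | nia].
- move=> a IHa b IHb k x na /andP[mixa mixb]; rewrite geq_max => /andP[lea leb] ltK.
  move=> /all_hashed_cat[ha hb] x_gt1 leG lena; rewrite expnD => ltx.
  have xa : 0 < x ^ degree a by rewrite expn_gt0; lia.
  have xb : 0 < x ^ degree b by rewrite expn_gt0; lia.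
  rewrite (IHa _ x) ?(IHb _ x) //; [lia | nia | nia].
- move=> y a IHa b IHb k x na /andP[mixa mixb]; rewrite !geq_max => /and3P[ley lea leb] ltK.
  move=> /all_hashed_cat[ha hb] x_gt1 leG lena; rewrite mulnS expnD expnM => ltx.
  have lexx : x <= x ^ degree a by rewrite -{1}[x]expn1 leq_pexp2l ?degree_gt0 // ltnW.
  have xb : 0 < (x ^ degree a) ^ degree b by rewrite expn_gt0; lia.
  have le_a : eval v w na a <= x ^ degree a by apply: eval_le_expn lea lena.
  rewrite (IHa _ x) //; last by nia.
  apply: eq_bigr => i _; have lti := ltn_ord i.
  apply: (IHb _ (x ^ degree a)) => //; [lia | | lia | lia | |].
  + apply: all_hashed_agree hb; first by lia.
    by move=> z leKz; rewrite upd_neq //; lia.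
  + by move=> z ltz; rewrite /upd; case: eqP => _; [lia | apply: leq_trans lexx; apply: lena].
  + by rewrite upd_neq; [nia | lia].
- move=> m IHm k x na mod_m lem ltK [[sep_v hash_v] _] x_gt1 leG lena ltx.
  have lexx : x <= x ^ degree m by rewrite -{1}[x]expn1 leq_pexp2l ?degree_gt0 // ltnW.
  apply: (@eval_lookupE _ K k (k + 7) (k + 11) (k + 12) m G v v w) => //; try lia.
    by move=> z /lena; lia.
  by apply: leq_ltn_trans ltx; apply: eval_le_expn lem lena.
Qed.

Lemma var_bound_ESum y a e n :
  y < n -> var_bound a <= n -> var_bound e <= n -> var_bound (ESum y a e) <= n.
Proof. by rewrite /= !geq_max => -> -> ->. Qed.

Lemma var_bound_EFirst y y' a e n :
  y < n -> y' < n -> var_bound a <= n -> var_bound e <= n ->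
  var_bound (EFirst y y' a e) <= n.
Proof. by move=> lty lty' lea lee; rewrite /= !geq_max lty lty' lea lee. Qed.

Lemma var_bound_EPow a d n : var_bound a <= n -> var_bound (EPow a d) <= n.
Proof. by move=> lea; elim: d => //= d IHd; rewrite geq_max lea. Qed.

(** Let [D = K + degree m + 4] and let [b >= 2] bound the order of the graph. Then [b ^ D] dominates
    both the letters, at most [b ^ degree m], and the requirement
    [#|G| ^ 2 * b ^ K + b ^ K <= b ^ K.+3] of the hashing. A prime up to [8 * (b ^ D) ^ 2] is at
    most [b ^ (2 * D + 3)]. *)
Definition hash_degree K m := 2 * (K + degree m + 4) + 3.

(** The search accepts the least [p] with a separating shift below it, prime or not; the existence
    of a suitable prime bounds how far the search must go. *)
Definition modulusE K k m :=
  EFirst (k + 3) (k + 6) (EAdd (EPow (EVar K) (hash_degree K m)) (ECst 1))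
    (ESum (k + 4) (EVar (k + 3)) (separatesE K k (k + 3) (k + 4) (k + 5) m)).

Definition shiftE K k m :=
  EFirst (k + 8) (k + 10) (EVar (k + 7)) (separatesE K k (k + 7) (k + 8) (k + 9) m).

Fixpoint bind_hashes K k ms e : expr l :=
  if ms is m :: ms' then
    ELet (k + 7) (modulusE K k m) (ELet (k + 11) (shiftE K k m)
      (ELet (k + 12) (hashE K k (k + 7) (k + 11) m) (bind_hashes K (k + 13) ms' e)))
  else e.

Lemma separates_exists K b m G (v : G) :
  modal m -> var_bound m <= K -> 1 < b -> #|G| <= b ->
  exists2 p, p < b ^ hash_degree K m + 1 & exists2 q, q < p & separates K b p q m v.
Proof.
move=> mod_m lem b_gt1 leGb; set D := K + degree m + 4.
have b_gt0 : 0 < b by lia.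
have bD_gt1 : 1 < b ^ D by rewrite -(exp1n D) ltn_exp2r // /D; lia.
have [p [p_pr ltp lep]] := prime_between bD_gt1.
have le_val (u : G) j : mval K b m u j < p.
  apply: leq_ltn_trans ltp; apply: (@leq_trans (b ^ degree m)).
    apply: (@eval_le_expn _ _ K) => // z ltz; exact/ltnW/decode_lt.
  by rewrite leq_pexp2l // /D; lia.
have le_p : #|G| ^ 2 * b ^ K + b ^ K < p.
  apply: leq_ltn_trans ltp; apply: (@leq_trans (b ^ K.+3)); last first.
    by rewrite leq_pexp2l // /D; lia.
  rewrite -addn3 expnD; apply: (@leq_trans (b ^ K * (b ^ 2 + 1))).
    by rewrite mulnDr muln1 leq_add2r mulnC leq_mul2l leq_exp2r ?leGb ?orbT.
  rewrite leq_mul2l; apply/orP; right.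
  by rewrite !expnS expn0; nia.
(* This shift separates the strings of all vertices of the graph, in particular of those two steps
   away from [v]. *)
have [q ltq sepq] := cauchy_hash p_pr (fun u j _ => le_val u j) le_p.
exists p; last by exists q => // w u _ _ eq_h j ltj; apply: sepq.
have -> : b ^ hash_degree K m = b ^ 3 * (b ^ D) ^ 2.
  by rewrite /hash_degree -/D -expnM -expnD; congr (_ ^ _); lia.
rewrite addn1 ltnS (leq_trans lep) // leq_mul2r; apply/orP; right.
by rewrite (leq_exp2r 2 b (isT : 0 < 3)).
Qed.

Lemma eval_bind_hashes K k ms G (v : G) na :
  all (fun m => modal m && (var_bound m <= K)) ms -> K < k ->
  1 < na K -> #|G| <= na K ->
  exists na', [/\ forall z, z < k -> na' z = na z, all_hashed K k ms v na' &
    forall e, eval v v na (bind_hashes K k ms e) = eval v v na' e].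
Proof.
elim: ms k na => [|m ms IHms] k na; first by exists na.
move=> /andP[/andP[mod_m lem] mod_ms] ltKk b_gt1 leGb.
have vb_sep3 : var_bound (separatesE K k (k + 3) (k + 4) (k + 5) m) <= k + 6.
  by apply: var_bound_separatesE; lia.
have vb_sep8 : var_bound (separatesE K k (k + 7) (k + 8) (k + 9) m) <= k + 10.
  by apply: var_bound_separatesE; lia.
set p := eval v v na (modulusE K k m); set na1 := upd na (k + 7) p.
have na1E z : z != k + 7 -> na1 z = na z by move=> ?; rewrite /na1 upd_neq.
have [ltp [q0 ltq0 sep0]] : p < na K ^ hash_degree K m + 1 /\
    exists2 q, q < p & separates K (na K) p q m v.
  (* The sum over the shifts is nonzero exactly when one of them separates, so it acts as an
     existential quantifier. *)
  have sumE i : eval v v (upd na (k + 3) i)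
      (ESum (k + 4) (EVar (k + 3)) (separatesE K k (k + 3) (k + 4) (k + 5) m)) != 0
    <-> exists2 q, q < i & separates K (na K) i q m v.
    set na' := upd na (k + 3) i.
    rewrite -[eval _ _ _ _]/(\sum_(q < na' (k + 3)) eval v v (upd na' (k + 4) q)
      (separatesE K k (k + 3) (k + 4) (k + 5) m)) [na' (k + 3)]upd_eq.
    have goodP q : eval v v (upd na' (k + 4) q) (separatesE K k (k + 3) (k + 4) (k + 5) m) != 0
        <-> separates K (na K) i q m v.
      rewrite eval_separatesE //; try lia.
      have -> : upd na' (k + 4) q K = na K by rewrite /na'; upd_simp.
      have -> : upd na' (k + 4) q (k + 3) = i by rewrite /na'; upd_simp.
      by rewrite upd_eq.
    rewrite sum_nat_eq0 negb_forall.
    split=> [/existsP[q /goodP sepq]|[q ltq /goodP sepq]]; first by exists q.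
    by apply/existsP; exists (Ordinal ltq).
  have [| | | ltp /sumE sepp] := @eval_EFirst l G v v (k + 3) (k + 6)
    (EAdd (EPow (EVar K) (hash_degree K m)) (ECst 1))
    (ESum (k + 4) (EVar (k + 3)) (separatesE K k (k + 3) (k + 4) (k + 5) m)) na.
  - rewrite -[var_bound _]/(maxn (k + 4).+1 (maxn (k + 3).+1
      (var_bound (separatesE K k (k + 3) (k + 4) (k + 5) m)))) 2!geq_max vb_sep3; lia.
  - lia.
  - have [p0 ltp0 sepp0] := separates_exists v mod_m lem b_gt1 leGb.
    exists p0; last by apply/sumE.
    by rewrite -[eval _ _ _ _]/(eval _ _ _ (EPow _ _) + 1) eval_EPow.
  by split=> //; rewrite -[X in _ < X + 1](eval_EPow v v (EVar K)).
set q := eval v v na1 (shiftE K k m); set na2 := upd na1 (k + 11) q.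
have [ltq sepq] : q < p /\ separates K (na K) p q m v.
  have goodP i : eval v v (upd na1 (k + 8) i) (separatesE K k (k + 7) (k + 8) (k + 9) m) != 0
    <-> separates K (na K) p i m v.
    rewrite eval_separatesE //; try lia.
    have -> : upd na1 (k + 8) i K = na K by rewrite /na1; upd_simp.
    have -> : upd na1 (k + 8) i (k + 7) = p by rewrite /na1; upd_simp.
    by rewrite upd_eq.
  have [| | | ltq /goodP sepq] := @eval_EFirst l G v v (k + 8) (k + 10) (EVar (k + 7))
    (separatesE K k (k + 7) (k + 8) (k + 9) m) na1.
  - exact: vb_sep8.
  - lia.
  - by exists q0; [rewrite -[eval _ _ _ _]/(na1 (k + 7)) [na1 _]upd_eq | apply/goodP].
  by split=> //; move: ltq; rewrite -[eval _ _ _ (EVar _)]/(na1 (k + 7)) [na1 (k + 7)]upd_eq.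
set r := eval v v na2 (hashE K k (k + 7) (k + 11) m); set na3 := upd na2 (k + 12) r.
have na3E z : z < k + 7 -> na3 z = na z.
  by move=> ltz; rewrite /na3 /na2 /na1 !upd_neq //; lia.
have hashed3 : hashed K k m v na3.
  have E7 : na3 (k + 7) = p by rewrite /na3 /na2 /na1; upd_simp.
  have E11 : na3 (k + 11) = q by rewrite /na3 /na2 /na1; upd_simp.
  rewrite /hashed na3E ?E7 ?E11; last by lia.
  split=> //; rewrite [LHS]upd_eq /r eval_hashE //; try lia.
  have -> : na2 K = na K by rewrite /na2 /na1; upd_simp.
  have -> : na2 (k + 7) = p by rewrite /na2 /na1; upd_simp.
  by rewrite [na2 (k + 11)]upd_eq.
have [| | | |na' [na'E hashed' evE]] := IHms (k + 13) na3 => //.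
- by lia.
- by rewrite na3E; lia.
- by rewrite na3E; lia.
exists na'; split=> [z ltz||e].
- by rewrite na'E ?na3E; lia.
- by split=> //; move: hashed3; rewrite /hashed !na'E //; lia.
rewrite eval_ELet -/p -/na1; last first.
  apply: var_bound_EFirst; [lia | lia | |].
    rewrite -[var_bound _]/(maxn (var_bound (EPow (EVar K) _)) 0) geq_max.
    by rewrite var_bound_EPow //=; lia.
  apply: var_bound_ESum; [lia | by rewrite /=; lia |].
  by apply: leq_trans vb_sep3 _; lia.
rewrite eval_ELet -/q -/na2; last first.
  apply: var_bound_EFirst; [lia | lia | by rewrite /=; lia |].
  by apply: leq_trans vb_sep8 _; lia.
by rewrite eval_ELet -/r -/na3 ?evE //; apply: var_bound_hashE; lia.
Qed.

End Key.

(** * Elimination of exchanges *)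

Section Norm.
Variable l : nat.
Implicit Types (G : lgraph l) (e a m : expr l) (na : nat -> nat) (ms : seq (expr l)).

Lemma modal_box K c e : modal (box K (EVar c) e) = modal e.
Proof. by elim: K e => //= K IHK e; rewrite IHK. Qed.

Lemma modal_encodeE K c : modal (encodeE K (EVar c) : expr l).
Proof. by elim: K => //= K ->. Qed.

Lemma modal_hashE K k p q m : modal m -> modal (hashE K k p q m).
Proof. by move=> mod_m; rewrite /hashE modal_box /= mod_m !modal_encodeE. Qed.

Lemma modal_ELet y a e : modal a -> modal e -> modal (ELet y a e).
Proof. by move=> /= -> ->. Qed.

Lemma modal_EFirst y y' a e : modal a -> modal e -> modal (EFirst y y' a e).
Proof. by move=> /= -> ->. Qed.

Lemma modal_separatesE K k p q r m : modal m -> modal (separatesE K k p q r m).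
Proof.
move=> mod_m; have mod_h := modal_hashE K k p q mod_m.
apply: modal_ELet => //; rewrite -[modal _]/(modal (box _ _ _) && true) modal_box.
by rewrite andbT; apply: modal_ELet => //=; rewrite mod_h mod_m.
Qed.

Lemma modal_EPow a n : modal a -> modal (EPow a n).
Proof. by move=> mod_a; elim: n => //= n ->; rewrite mod_a. Qed.

Lemma modal_bind_hashes K k ms e :
  all (@modal l) ms -> modal e -> modal (bind_hashes K k ms e).
Proof.
move=> + mod_e; elim: ms k => // m ms IHms k /andP[mod_m mod_ms].
apply: modal_ELet.
  apply: modal_EFirst; first by rewrite -[modal _]/(modal (EPow _ _) && true) modal_EPow.
  exact: modal_separatesE.
apply: modal_ELet; first by apply: modal_EFirst => //; apply: modal_separatesE.
by apply: modal_ELet; [apply: modal_hashE | apply: IHms].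
Qed.

Lemma modal_use_hashes K k e : mix e -> modal (use_hashes K k e).
Proof.
elim: e k => //= [a IHa b IHb|a IHa b IHb|a IHa b IHb|y a IHa b IHb|m _] k;
  try by case/andP=> ? ?; rewrite IHa ?IHb.
by move=> mod_m; rewrite modal_hashE.
Qed.

Lemma leaves_modal K e : mix e -> var_bound e <= K ->
  all (fun m => modal m && (var_bound m <= K)) (leaves e).
Proof.
elim: e => //= [a IHa b IHb|a IHa b IHb|a IHa b IHb|y a IHa b IHb|m _];
  try by move=> /andP[mixa mixb]; rewrite !geq_max => le_ab;
    rewrite all_cat IHa ?IHb //; lia.
by move=> -> ->.
Qed.

(** A number that can serve as the base [x] of [eval_le_expn], computed by an expression. *)
Fixpoint sizeE K : expr l :=
  if K is K'.+1 then EAdd (sizeE K') (EVar K') else EAdd (ECst 2) EOrd.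

Lemma var_bound_sizeE K : var_bound (sizeE K) <= K.
Proof. by elim: K => //= K IHK; rewrite geq_max leqnn leqW. Qed.

Lemma modal_sizeE K : modal (sizeE K).
Proof. by elim: K => //= K ->. Qed.

Lemma eval_sizeE K G (u v : G) na : let x := eval u v na (sizeE K) in
  [/\ 1 < x, #|G| <= x & forall z, z < K -> na z <= x].
Proof.
elim: K => /= [|K [x_gt1 leGx le_na]]; first by split=> //; lia.
split=> [||z]; [lia | lia | rewrite ltnS leq_eqVlt => /predU1P[->|/le_na]]; lia.
Qed.

(** A strict bound for [e] is stored under the fresh name [K], then modulus, shift and hash of each
    leaf are computed at [v], all before the step to the neighbours [w]; there each leaf is looked
    up by its hash. *)
Lemma modal_neighbour_sum e : mix e -> exists2 m, modal m &
  forall G (u v : G) na, eval u v na (ENb e) = eval u v na m.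
Proof.
move=> mix_e; pose K := var_bound e.
pose B := EAdd (EPow (sizeE K) (degree e)) (ECst 1).
have modal_hashes : modal (bind_hashes K K.+1 (leaves e) (ENb (use_hashes K K.+1 e))).
  apply: modal_bind_hashes; last exact: modal_use_hashes.
  by apply: sub_all (leaves_modal mix_e (leqnn K)) => m /andP[].
exists (ELet K B (bind_hashes K K.+1 (leaves e) (ENb (use_hashes K K.+1 e)))).
  apply: modal_ELet.
    by rewrite -[modal B]/(modal (EPow _ _) && true) modal_EPow ?modal_sizeE.
  exact: modal_hashes.
move=> G u v na; have bound_B : var_bound B <= K.
  rewrite /= geq_max andbT; elim: (degree e) => //= n IHn.
  by rewrite geq_max var_bound_sizeE.
rewrite eval_ELet //; set na1 := upd _ _ _.
have [x_gt1 leGx le_na] := eval_sizeE K u v na; set x := eval _ _ _ _ in x_gt1 leGx le_na.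
have na1K : na1 K = x ^ degree e + 1 by rewrite /na1 upd_eq /B /= eval_EPow.
have lexx : x <= x ^ degree e by rewrite -{1}[x]expn1 leq_pexp2l ?degree_gt0 // ltnW.
have b_gt1 : 1 < na1 K by rewrite na1K; lia.
have leGb : #|G| <= na1 K by rewrite na1K; lia.
have [na' [na'E hashed evE]] :=
  eval_bind_hashes v (leaves_modal mix_e (leqnn K)) (leqnn K.+1) b_gt1 leGb.
(* What remains is modal, so [u] may be replaced by [v], as [eval_bind_hashes] works on the
   diagonal. *)
rewrite (@eval_modal l _ G u v v na1 modal_hashes).
have eq_na z : z < K -> na' z = na z by move=> ltz; rewrite na'E /na1 ?upd_neq; lia.
rewrite evE /=; apply: eq_bigr => w vw; rewrite (@eval_use_hashes _ e K K.+1 x G v w) //.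
- by apply: eval_agree => z /eq_na.
- by move=> z ltz; rewrite eq_na ?le_na.
- by rewrite na'E // na1K; lia.
Qed.

(** Since [mix] admits [ESwap] around modal expressions only, an outer exchange is pushed inwards
    until it meets a label, a neighbour sum or another exchange, which it cancels. *)
Fixpoint swap e : expr l :=
  match e with
  | EVar _ | ECst _ | EOrd => e
  | ELab _ | ENb _ => ESwap e
  | EAdd a b => EAdd (swap a) (swap b)
  | EMul a b => EMul (swap a) (swap b)
  | ELe a b => ELe (swap a) (swap b)
  | ESum y a b => ESum y (swap a) (swap b)
  | ESwap a => a
  end.

Lemma modal_mix e : modal e -> mix e.
Proof.
by elim: e => //= [a IHa b IHb|a IHa b IHb|a IHa b IHb|y a IHa b IHb] /andP[/IHa-> /IHb->].
Qed.

Lemma mix_swap e : mix e -> mix (swap e).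
Proof.
by elim: e => //= [a IHa b IHb|a IHa b IHb|a IHa b IHb|y a IHa b IHb|a _];
  [case/andP=> /IHa-> /IHb->..|exact: modal_mix].
Qed.

Lemma eval_swap e G (u v : G) na : eval u v na (swap e) = eval v u na e.
Proof.
elim: e na => //= [a IHa b IHb|a IHa b IHb|a IHa b IHb|y a IHa b IHb] na;
  rewrite IHa ?IHb //.
by apply: eq_bigr => i _; apply: IHb.
Qed.

(** By induction the body of a neighbour sum may be taken in [mix] form, and then
    [modal_neighbour_sum] makes the whole sum modal; exchanges are absorbed by [swap]. *)
Lemma mix_normal_form e : exists2 e', mix e' &
  forall G (u v : G) na, eval u v na e' = eval u v na e.
Proof.
elim: e => [y|n||i|a [a' ma ea] b [b' mb eb]|a [a' ma ea] b [b' mb eb]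
  |a [a' ma ea] b [b' mb eb]|y a [a' ma ea] b [b' mb eb]|a [a' ma ea]|a [a' ma ea]].
- by exists (EVar y).
- by exists (ECst n).
- by exists EOrd.
- by exists (ELab i).
- by exists (EAdd a' b') => [|G u v na] /=; rewrite ?ma ?ea ?eb.
- by exists (EMul a' b') => [|G u v na] /=; rewrite ?ma ?ea ?eb.
- by exists (ELe a' b') => [|G u v na] /=; rewrite ?ma ?ea ?eb.
- exists (ESum y a' b') => [|G u v na] /=; rewrite ?ma ?ea //.
  by apply: eq_bigr => i _; apply: eb.
- have [m mod_m em] := modal_neighbour_sum ma.
  exists m => [|G u v na]; first exact: modal_mix.
  by rewrite -em; apply: eq_bigr => w _; apply: ea.
- exists (swap a') => [|G u v na]; first exact: mix_swap.
  by rewrite eval_swap.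
Qed.

(* On the diagonal [ESwap] is the identity, so it can be erased. *)
Fixpoint unswap e : expr l :=
  match e with
  | EVar _ | ECst _ | EOrd | ELab _ | ENb _ => e
  | EAdd a b => EAdd (unswap a) (unswap b)
  | EMul a b => EMul (unswap a) (unswap b)
  | ELe a b => ELe (unswap a) (unswap b)
  | ESum y a b => ESum y (unswap a) (unswap b)
  | ESwap a => a
  end.

Lemma modal_diagonal e : exists2 m, modal m &
  forall G (v : G) na, eval v v na e = eval v v na m.
Proof.
have [e' mix_e' eE] := mix_normal_form e; exists (unswap e') => [|G v na].
  elim: e' mix_e' {eE} => //= [a IHa b IHb|a IHa b IHb|a IHa b IHb|y a IHa b IHb];
    by case/andP=> /IHa-> /IHb->.
rewrite -eE; elim: e' na {mix_e' eE} =>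
  //= [a IHa b IHb|a IHa b IHb|a IHa b IHb|y a IHa b IHb] na;
  rewrite IHa ?IHb //.
by apply: eq_bigr => i _; apply: IHb.
Qed.
End Norm.

(** * Translation from and to the logics *)

(** The first bound belongs to the innermost sum, which is the nesting that [let_chain] produces. *)
Fixpoint sum_below (bs : seq nat) (F : seq nat -> nat) : nat :=
  if bs is b :: bs' then sum_below bs' (fun s => \sum_(i < b) F ((i : nat) :: s))
  else F [::].

Lemma eq_sum_below bs F F' : (forall s, size s = size bs -> F s = F' s) ->
  sum_below bs F = sum_below bs F'.
Proof.
elim: bs F F' => [|b bs IHbs] F F' eqF /=; first exact: eqF.
by apply: IHbs => s size_s; apply: eq_bigr => i _; apply: eqF; rewrite /= size_s.
Qed.

Lemma exchange_sum_below (I : finType) (P : pred I) bs (F : I -> seq nat -> nat) :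
  \sum_(i | P i) sum_below bs (F i) = sum_below bs (fun s => \sum_(i | P i) F i s).
Proof.
elim: bs F => //= b bs IHbs F; rewrite IHbs; apply: eq_sum_below => s _.
exact: exchange_big.
Qed.

(** This passes from the tuples below a common maximum, used by the semantics of counting terms, to
    nested sums. *)
Lemma sum_tuple_below M bs k F : size bs = k -> all (geq M) bs ->
  \sum_(t : k.-tuple 'I_M | [forall j, tnth t j < nth 0 bs j]) F (map val t)
  = sum_below bs F.
Proof.
elim: bs k F => [|b bs IHbs] k F /= <- {k}.
  move=> _; rewrite (big_pred1 [tuple]) // => t.
  by apply/forallP/eqP => [_|_ []//]; apply: tuple0.
case/andP=> leb le_bs.
rewrite -(IHbs _ (fun s => \sum_(i < b) F ((i : nat) :: s)) erefl le_bs).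
pose h (x : 'I_M * (size bs).-tuple 'I_M) := [tuple of x.1 :: x.2].
pose g (t : (size bs).+1.-tuple 'I_M) := (thead t, [tuple of behead t]).
rewrite (reindex h) /=; last first.
  exists g => [[i t] _|t _]; rewrite /g /h /=.
    by rewrite theadE; congr (_, _); apply/val_inj.
  by rewrite [RHS]tuple_eta; apply/val_inj.
have forallE (i : 'I_M) (t : (size bs).-tuple 'I_M) :
    [forall j, tnth (h (i, t)) j < nth 0 (b :: bs) j]
    = [forall j, tnth t j < nth 0 bs j] && (i < b).
  apply/forallP/andP => [lt_h|[/forallP lt_t lti] j].
    split; last by have := lt_h ord0; rewrite /h tnth0.
    by apply/forallP => j; have := lt_h (lift ord0 j); rewrite /h tnthS.
  by case: (unliftP ord0 j) => [j'|] ->; rewrite /h ?tnthS ?tnth0.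
rewrite -(pair_big_dep xpredT (fun i t => [forall j, tnth (h (i, t)) j < nth 0 (b :: bs) j])
   (fun i t => F (map val (h (i, t))))) /=.
under eq_bigr => i _.
  rewrite (eq_bigl _ _ (forallE i)) big_mkcondr.
  over.
rewrite exchange_big /=; apply: eq_bigr => t _.
by rewrite (big_ord_widen M (fun i => F (i :: map val t)) leb) [RHS]big_mkcond.
Qed.

Lemma term_value_TCount l (G : lgraph l) va na xs ys psi :
  term_value va na (TCount xs ys psi)
  = \sum_(g : (size xs).-tuple G)
      sum_below [seq term_value va na p.2 | p <- ys]
        (fun s => holds (update va xs g) (update na (map fst ys) s) psi).
Proof.
rewrite /=; set bs := map _ ys; set M := \max_(b <- bs) b.
rewrite cardsE -sum1_card big_mkcond /=.
have le_bs : all (geq M) bs.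
  by apply/allP => b b_bs; rewrite /= /M (bigmaxn_sup_seq b).
pose Q g (t : (size ys).-tuple 'I_M) := [forall j, tnth t j < nth 0 bs j]
  && holds (update va xs g) (update na (map fst ys) (map val t)) psi.
transitivity (\sum_(p : (size xs).-tuple G * (size ys).-tuple 'I_M) Q p.1 p.2).
  by apply: eq_bigr => p _; rewrite unfold_in -/(Q p.1 p.2); case: (Q _ _).
rewrite -(pair_bigA _ (fun (g : (size xs).-tuple G) t => nat_of_bool (Q g t))) /=.
apply: eq_bigr => g _.
rewrite -(@sum_tuple_below M _ (size ys)) ?size_map // [RHS]big_mkcond.
by apply: eq_bigr => t _; rewrite /Q; case: [forall _, _].
Qed.

Lemma term_value_TCount0 l (G : lgraph l) (va : nat -> G) na ys psi :
  term_value va na (TCount [::] ys psi)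
  = sum_below [seq term_value va na p.2 | p <- ys]
      (fun s => holds (update va [::] [::]) (update na (map fst ys) s) psi).
Proof.
rewrite term_value_TCount (big_pred1 [tuple]) // => g.
by rewrite (tuple0 g); apply/esym/eqP.
Qed.

Lemma term_value_TCount1 l (G : lgraph l) (va : nat -> G) na x ys psi :
  term_value va na (TCount [:: x] ys psi)
  = \sum_(w : G) sum_below [seq term_value va na p.2 | p <- ys]
      (fun s => holds (update va [:: x] [:: w]) (update na (map fst ys) s) psi).
Proof.
rewrite term_value_TCount (reindex (fun w : G => [tuple w])) //=.
exists (fun t => thead t) => [w _|t _]; first by rewrite theadE.
by case/tupleP: t => w t; rewrite (tuple0 t) theadE; apply/val_inj.
Qed.

Section LetChain.
Variable l : nat.
Implicit Types (G : lgraph l) (e a m : expr l) (na : nat -> nat) (zs : seq (nat * expr l)).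

(* The bounds of a counting term are evaluated outside the scope of its variables: they
   are stored under fresh names before the nested sums start. *)
Fixpoint let_chain zs z e : expr l :=
  if zs is (y, a) :: zs' then ELet z a (let_chain zs' z.+1 (ESum y (EVar z) e)) else e.

Lemma update_cons (T : Type) (a : nat -> T) y ys i s x :
  update a (y :: ys) (i :: s) x = if x == y then i else update a ys s x.
Proof. by rewrite /update /= eq_sym; case: eqP. Qed.

Lemma update_notin (T : Type) (a : nat -> T) ys s x :
  size s <= size ys -> x \notin ys -> update a ys s x = a x.
Proof.
move=> le_s; rewrite -index_mem -leqNgt => le_i.
by rewrite /update nth_default ?(leq_trans le_s).
Qed.

Lemma update_agree (T : Type) (a a' : nat -> T) ys s x :
  a x = a' x -> update a ys s x = update a' ys s x.
Proof. by rewrite /update => ->. Qed.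

Lemma eval_let_chain zs z0 z e G (u v : G) na :
  all (fun p => (p.1 < z0) && (var_bound p.2 <= z0)) zs -> z0 <= z ->
  exists2 na', (forall x, x < z -> na' x = na x) &
  eval u v na (let_chain zs z e) = sum_below [seq eval u v na p.2 | p <- zs]
    (fun s => eval u v (update na' (map fst zs) s) e).
Proof.
move=> + le_z; elim: zs z e na le_z => [|[y a] zs IHzs] z e na le_z /=; first by exists na.
case/andP=> /andP[lty lea] lt_zs; set b := eval u v na a; set na1 := upd na z b.
have [||na' na'E evE] := IHzs z.+1 (ESum y (EVar z) e) na1; [lia | by [] |].
exists na' => [x ltx|]; first by rewrite na'E ?/na1 ?upd_neq; lia.
rewrite -[LHS]/(eval u v na (ELet z a (let_chain zs z.+1 (ESum y (EVar z) e)))).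
rewrite eval_ELet ?(leq_trans lea) // evE.
have -> : [seq eval u v na1 p.2 | p <- zs] = [seq eval u v na p.2 | p <- zs].
  elim: zs lt_zs {IHzs evE} => //= p zs IHzs /andP[/andP[_ lep] /IHzs->].
  by congr (_ :: _); apply: eval_agree => x ltx; rewrite /na1 upd_neq //; lia.
apply: eq_sum_below => s; rewrite size_map => size_s.
rewrite -[LHS]/(\sum_(i < update na' (map fst zs) s z) _).
(* The stored bound survives, since all bound names lie below [z0 <= z]. *)
have -> : update na' (map fst zs) s z = b.
  rewrite update_notin ?size_map ?size_s // ?na'E ?/na1 ?upd_eq //.
  have lt_ys : all (gtn z0) (map fst zs).
    by rewrite all_map; apply: sub_all lt_zs => p /andP[].
  by apply: contraTN le_z => /(allP lt_ys); rewrite -ltnNge.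
apply: eq_bigr => i _; apply: eval_ext => x.
by rewrite update_cons.
Qed.
End LetChain.

Scheme fragment_term_mut := Minimality for fragment_term Sort Prop
  with fragment_form_mut := Minimality for fragment_form Sort Prop.
Combined Scheme fragment_mut from fragment_term_mut, fragment_form_mut.

Section Translation.
Variable l : nat.
Implicit Types (G : lgraph l) (e a m : expr l) (na : nat -> nat) (zs : seq (nat * expr l)).

Lemma fragment_sub :
  (forall t : term l, fragment_term Modal t -> fragment_term Guarded t) /\
  (forall phi : form l, fragment_form Modal phi -> fragment_form Guarded phi).
Proof.
apply: (@fragment_mut l Modal (fragment_term Guarded) (fragment_form Guarded));
  by intros; constructor; auto.
Qed.

(* Below the first counting over neighbours the two variables are adjacent; before
   it they may be given the same value. *)
Definition placed (diagonal : bool) G (u v : G) : Prop :=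
  if diagonal then u = v else edge u v.

Definition value_is (d : bool) (val : forall G, (nat -> G) -> (nat -> nat) -> nat) e :=
  forall G (va : nat -> G) na, placed d (va 1) (va 2) ->
  val G va na = eval (va 1) (va 2) na e.

Lemma bounds_value d (ys : seq (nat * term l)) :
  (forall (y : nat) theta, List.In (y, theta) ys ->
     forall d, exists e, value_is d (fun G va na => term_value va na theta) e) ->
  exists2 zs, map fst zs = map fst ys &
  forall G (va : nat -> G) na, placed d (va 1) (va 2) ->
    [seq term_value va na p.2 | p <- ys] = [seq eval (va 1) (va 2) na p.2 | p <- zs].
Proof.
elim: ys => [|[y t] ys IHys] ex_ys; first by exists [::].
have [|zs eq_zs zsE] := IHys; first by move=> y' t' ?; apply: (ex_ys y'); right.
have [e eE] := ex_ys y t (or_introl erefl) d.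
exists ((y, e) :: zs) => [|G va na pl] /=; first by rewrite eq_zs.
by rewrite eE // zsE.
Qed.

Lemma eval_simultaneous zs e : exists e', forall G (u v : G) na,
  eval u v na e' = sum_below [seq eval u v na p.2 | p <- zs]
    (fun s => eval u v (update na (map fst zs) s) e).
Proof.
pose z := maxn (var_bound e) (foldr (fun p n => maxn (maxn p.1.+1 (var_bound p.2)) n) 0 zs).
exists (let_chain zs z e) => G u v na.
have [||na' na'E ->] := @eval_let_chain _ zs z z e G u v na => //.
  have : foldr (fun p n => maxn (maxn p.1.+1 (var_bound p.2)) n) 0 zs <= z by rewrite leq_maxr.
  by move: (z) => {z na} z; elim: zs => //= p zs IHzs; rewrite !geq_max => /andP[-> /IHzs].
apply: eq_sum_below => s _; apply: eval_agree => x ltx; apply: update_agree.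
by apply: na'E; apply: leq_trans ltx (leq_maxl _ _).
Qed.

(** The pair of an expression is formed by the values of the variables 1 and 2, and these are always
    equal or adjacent. Hence edge and equality atoms between the two are constants, depending only
    on [d]. *)
Lemma guarded_value :
  (forall t : term l, fragment_term Guarded t ->
     forall d, exists e, value_is d (fun G va na => term_value va na t) e) /\
  (forall phi : form l, fragment_form Guarded phi ->
     forall d, exists e, value_is d (fun G va na => holds va na phi) e).
Proof.
apply: (@fragment_mut l Guarded
  (fun t => forall d, exists e, value_is d (fun G va na => term_value va na t) e)
  (fun phi => forall d, exists e, value_is d (fun G va na => holds va na phi) e)).
- by move=> y d; exists (EVar y).
- by move=> d; exists (ECst 0).
- by move=> d; exists (ECst 1).
- by move=> d; exists EOrd.
- move=> t1 t2 _ IH1 _ IH2 d; have [[e1 E1] [e2 E2]] := (IH1 d, IH2 d).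
  by exists (EAdd e1 e2) => G va na pl /=; rewrite E1 ?E2.
- move=> t1 t2 _ IH1 _ IH2 d; have [[e1 E1] [e2 E2]] := (IH1 d, IH2 d).
  by exists (EMul e1 e2) => G va na pl /=; rewrite E1 ?E2.
- move=> ys psi _ _ IHys _ IHpsi d.
  have [zs eq_zs zsE] := bounds_value d IHys; have [e eE] := IHpsi d.
  have [e' e'E] := eval_simultaneous zs e; exists e' => G va na pl.
  rewrite term_value_TCount0 e'E (zsE _ _ _ pl).
  by apply: eq_sum_below => s _; rewrite eE // eq_zs.
- move=> i ys psi i12 _ _ IHys _ IHpsi _ d.
  have [zs eq_zs zsE] := bounds_value d IHys; have [e eE] := IHpsi false.
  (* For [i = 1] the vertex 1 must become current before its neighbours are summed over. For [i = 2]
     the neighbour found is the new vertex 1, so the exchange comes after the step. *)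
  pose body := if i == 1 then ESwap (ENb e) else ENb (ESwap e).
  have [e' e'E] := eval_simultaneous zs body; exists e' => G va na pl.
  rewrite term_value_TCount1 e'E (zsE _ _ _ pl) exchange_sum_below.
  apply: eq_sum_below => s _; rewrite eq_zs; set na' := update na _ s.
  rewrite /body; move: i12; rewrite !inE => /orP[]/eqP-> /=.
    rewrite [RHS]big_mkcond /=; apply: eq_bigr => w _.
    rewrite -[update va [:: 3 - 1] [:: w] 1]/(va 1) -[update va [:: 3 - 1] [:: w] _]/w.
    by case: ifP => //= vw; rewrite eE.
  rewrite [RHS]big_mkcond /=; apply: eq_bigr => w _.
  rewrite -[update va [:: 3 - 2] [:: w] 2]/(va 2) -[update va [:: 3 - 2] [:: w] _]/w.
  by case: ifP => //= vw; rewrite eE //= /placed /= edge_sym.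
- move=> i j; rewrite !inE => /orP[]/eqP-> /orP[]/eqP-> d.
  + by exists (ECst 0) => G va na _ /=; rewrite edge_irrefl.
  + exists (ECst (~~ d)) => G va na /=.
    by case: d => /= [->|->] //; rewrite edge_irrefl.
  + exists (ECst (~~ d)) => G va na /=.
    by case: d => /= [->|]; rewrite ?edge_irrefl // edge_sym => ->.
  + by exists (ECst 0) => G va na _ /=; rewrite edge_irrefl.
- move=> P i; rewrite !inE => /orP[]/eqP-> d.
    by exists (ESwap (ELab P)).
  by exists (ELab P).
- move=> i j; rewrite !inE => /orP[]/eqP-> /orP[]/eqP-> d.
  + by exists (ECst 1) => G va na _ /=; rewrite eqxx.
  + exists (ECst d) => G va na /=; case: d => /= [->|]; first by rewrite eqxx.
    by case: eqP => // ->; rewrite edge_irrefl.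
  + exists (ECst d) => G va na /=; case: d => /= [->|]; first by rewrite eqxx.
    by case: eqP => // ->; rewrite edge_irrefl.
  + by exists (ECst 1) => G va na _ /=; rewrite eqxx.
- move=> t1 t2 _ IH1 _ IH2 d; have [[e1 E1] [e2 E2]] := (IH1 d, IH2 d).
  by exists (ELe e1 e2) => G va na pl /=; rewrite E1 ?E2.
- move=> psi _ IH d; have [e eE] := IH d.
  by exists (ENot e) => G va na pl; rewrite eval_ENot -eE //= eqb0.
- move=> psi1 psi2 _ IH1 _ IH2 d; have [[e1 E1] [e2 E2]] := (IH1 d, IH2 d).
  by exists (EMul e1 e2) => G va na pl /=; rewrite -E1 -?E2 // mulnb.
- move=> psi1 psi2 _ IH1 _ IH2 d; have [[e1 E1] [e2 E2]] := (IH1 d, IH2 d).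
  exists (ELt (ECst 0) (EAdd e1 e2)) => G va na pl; rewrite eval_ELt /= -E1 -?E2 //.
  by do 2!case: (holds _ _ _).
Qed.

End Translation.

(** * Modal expressions as terms of the modal logic *)

Section ToTerm.
Variable l : nat.
Implicit Types (G : lgraph l) (e a m : expr l) (na : nat -> nat).

Fixpoint size_term K : term l :=
  if K is K'.+1 then TAdd (size_term K') (TVar K') else TAdd (TAdd TOne TOne) TOrd.

Definition bound_term K d : term l := iter d (TMul (size_term K)) TOne.

Lemma bound_term_value K d G (va : nat -> G) na :
  term_value va na (bound_term K d) = eval (va 1) (va 1) na (sizeE l K) ^ d.
Proof.
rewrite /bound_term; elim: d => //= d ->; rewrite expnS; congr (_ * _).
by elim: K => //= K ->.
Qed.

(** Counting the empty tuple gives truth values. A sum of values of [b] becomes the count of the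
    pairs of an index and a [z] below the value of [b]; [z] has the name [K], and its range
    dominates the whole sum. Nested counts can share the name [K], as it is compared directly under
    its binder. The current vertex variable [s] switches at each step to a neighbour. *)
Fixpoint modal_term K s e : term l :=
  match e with
  | EVar y => TVar y
  | ECst n => iter n (TAdd TOne) TZero
  | EOrd => TOrd
  | ELab i => TCount [::] [::] (FLabel i s)
  | EAdd a b => TAdd (modal_term K s a) (modal_term K s b)
  | EMul a b => TMul (modal_term K s a) (modal_term K s b)
  | ELe a b => TCount [::] [::] (FLe (modal_term K s a) (modal_term K s b))
  | ESum y a b =>
      TCount [::] [:: (y, modal_term K s a); (K, bound_term K (degree e))]
        (FLe (TAdd (TVar K) TOne) (modal_term K s b))
  | ENb a =>
      TCount [:: 3 - s] [:: (K, bound_term K (degree e))]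
        (FAnd (FEdge s (3 - s)) (FLe (TAdd (TVar K) TOne) (modal_term K (3 - s) a)))
  | ESwap _ => TZero
  end.

(** This gives the side condition of modal counting: the body, written for [3 - s], does not mention
    [s]. *)
Lemma modal_term_free K s e :
  s \in [:: 1; 2] -> {subset tfree_vertex (modal_term K s e) <= [:: s]}.
Proof.
have size0 : tfree_vertex (size_term K) = [::] by elim: K => //= K ->.
have bound0 d : tfree_vertex (bound_term K d) = [::].
  by elim: d => //= d ->; rewrite size0.
elim: e s => //=.
- by move=> n s _; elim: n.
- by move=> i s _ x.
- by move=> a IHa b IHb s s12 x; rewrite mem_cat => /orP[/IHa|/IHb]; apply.
- by move=> a IHa b IHb s s12 x; rewrite mem_cat => /orP[/IHa|/IHb]; apply.
- move=> a IHa b IHb s s12 x; rewrite cats0 mem_filter /= mem_cat.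
  by case/orP => [/IHa|/IHb]; apply.
- move=> y a IHa b IHb s s12 x; rewrite ?bound0 !cats0 mem_cat mem_filter /=.
  by case/orP => [/IHb|/IHa]; apply.
- move=> a IHa s s12 x; rewrite size0 /= ?bound0 /= !cats0.
  have s12' : 3 - s \in [:: 1; 2] by move: s12; rewrite !inE => /orP[]/eqP->.
  have neq_s : s != 3 - s by move: s12; rewrite !inE; lia.
  rewrite !inE neq_s eqxx /= inE => /orP[//|].
  by rewrite mem_filter => /andP[neq_x /(IHa _ s12') x3]; rewrite x3 in neq_x.
Qed.

Lemma modal_term_fragment K s e : modal e -> var_bound e <= K -> s \in [:: 1; 2] ->
  fragment_term Modal (modal_term K s e).
Proof.
have boundM d : fragment_term Modal (bound_term K d).
  rewrite /bound_term; elim: d => [|d IHd] /=; constructor => //.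
  by elim: K {IHd} => [|K IHK] /=; repeat constructor.
elim: e s => //=.
- by move=> *; constructor.
- by move=> n s _ _ _; elim: n => [|n IHn] /=; repeat constructor.
- by move=> *; constructor.
- by move=> i s _ _ s12; repeat constructor.
- move=> a IHa b IHb s /andP[? ?]; rewrite geq_max => /andP[? ?] s12.
  by constructor; [apply: IHa | apply: IHb].
- move=> a IHa b IHb s /andP[? ?]; rewrite geq_max => /andP[? ?] s12.
  by constructor; [apply: IHa | apply: IHb].
- move=> a IHa b IHb s /andP[? ?]; rewrite geq_max => /andP[? ?] s12.
  by constructor => //; constructor; [apply: IHa | apply: IHb].
- move=> y a IHa b IHb s /andP[? ?]; rewrite !geq_max => /and3P[ltyK ? ?] s12.
  constructor.
  + by rewrite /= inE; lia.
  + by move=> y' t /= [[_ <-]|[[_ <-]|[]]] //; apply: IHa.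
  + by constructor; [repeat constructor | apply: IHb].
- move=> a IHa s mod_a lea s12.
  have s12' : 3 - s \in [:: 1; 2] by move: s12; rewrite !inE => /orP[]/eqP->.
  constructor => //.
  + by move=> y' t /= [[_ <-]|[]]; apply: (boundM (degree a).+1).
  + by constructor; [repeat constructor | apply: IHa].
  + move=> _ /=; apply: contraL s12 => /(modal_term_free s12').
    by rewrite !inE => /eqP; lia.
Qed.

Lemma modal_term_value K s e G (va : nat -> G) na :
  modal e -> var_bound e <= K -> s \in [:: 1; 2] ->
  term_value va na (modal_term K s e) = eval (va s) (va s) na e.
Proof.
have bnd e' (v : G) va' na' : var_bound e' <= K ->
    eval v v na' e' <= term_value (va' : nat -> G) na' (bound_term K (degree e')).
  move=> le_e'; rewrite bound_term_value.
  have [x_gt1 leGx le_na] := eval_sizeE K (va' 1) (va' 1) na'.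
  exact: eval_le_expn le_e' le_na.
elim: e s va na => [y|n||i|a IHa b IHb|a IHa b IHb|a IHa b IHb|y a IHa b IHb|a IHa|//] s va na.
- by [].
- by move=> _ _ _; rewrite -[RHS]/n; elim: n => //= n ->.
- by [].
- by move=> _ _ s12; rewrite [modal_term _ _ _]/= term_value_TCount0.
- move=> /andP[? ?]; rewrite [var_bound _]/= geq_max => /andP[? ?] s12.
  by rewrite /= IHa ?IHb.
- move=> /andP[? ?]; rewrite [var_bound _]/= geq_max => /andP[? ?] s12.
  by rewrite /= IHa ?IHb.
- move=> /andP[? ?]; rewrite [var_bound _]/= geq_max => /andP[? ?] s12.
  rewrite [modal_term _ _ _]/= term_value_TCount0.
  rewrite -[LHS]/(nat_of_bool (term_value _ _ (modal_term K s a)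
    <= term_value _ _ (modal_term K s b))).
  by rewrite IHa ?IHb.
- move=> /andP[mod_a mod_b] le_e s12; have le_val := bnd _ (va s) va na le_e.
  move: (le_e); rewrite [var_bound _]/= !geq_max => /and3P[lty lea leb].
  rewrite [modal_term _ _ _]/= term_value_TCount0.
  rewrite -[degree a * _]/(degree (ESum y a b)) [X in sum_below X]/= IHa //.
  move: (term_value _ _ (bound_term _ _)) le_val => B le_val.
  rewrite -[LHS]/(\sum_(z < B) \sum_(i < eval (va s) (va s) na a) nat_of_bool
    (update na [:: y; K] [:: (i : nat); (z : nat)] K + 1 <= term_value (update va [::] [::])
      (update na [:: y; K] [:: (i : nat); (z : nat)]) (modal_term K s b))).
  rewrite exchange_big; apply: eq_bigr => i _.
  (* For a fixed index the counted [z] number [minn B c], which is [c]: a summand is at most the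
     whole sum, hence at most [B]. *)
  pose c := eval (va s) (va s) (upd na y i) b.
  have le_c : c <= B by apply: leq_trans le_val; rewrite /= (bigD1 i) //= leq_addr.
  rewrite -[RHS]/c -[RHS](minn_idPr le_c) -sum_ltn_ord; apply: eq_bigr => z _.
  rewrite !update_cons (_ : K == y = false) ?eqxx ?addn1; last by lia.
  rewrite IHb //; congr (nat_of_bool (_ < _)); apply: eval_agree => x ltx.
  rewrite !update_cons /upd; case: eqP => // _.
  by case: eqP => // eq_x; lia.
- move=> mod_a lea s12; have le_val w : edge (va s) w ->
      eval (va s) w na a <= term_value va na (bound_term K (degree (ENb a))).
    move=> vw; apply: leq_trans (bnd (ENb a) (va s) va na lea).
    by rewrite /= (bigD1 w) //= leq_addr.
  have s12' : 3 - s \in [:: 1; 2] by move: s12; rewrite !inE => /orP[]/eqP->.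
  rewrite -[modal_term K s _]/(TCount [:: 3 - s] [:: (K, bound_term K (degree (ENb a)))]
    (FAnd (FEdge s (3 - s)) (FLe (TAdd (TVar K) TOne) (modal_term K (3 - s) a)))).
  rewrite term_value_TCount1.
  rewrite [map _ _](_ : _ = [:: term_value va na (bound_term K (degree (ENb a)))]) //.
  move: (term_value _ _ (bound_term _ _)) le_val => B le_val.
  rewrite -[RHS]/(\sum_(w | edge (va s) w) eval (va s) w na a) [RHS]big_mkcond.
  apply: eq_bigr => w _; set va' := update va _ _.
  have va's : va' s = va s by rewrite /va' update_cons; case: eqP => //; lia.
  have va's' : va' (3 - s) = w by rewrite /va' update_cons eqxx.
  rewrite -[LHS]/(\sum_(z < B) nat_of_bool (edge (va' s) (va' (3 - s)) &&
     (update na [:: K] [:: (z : nat)] K + 1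
       <= term_value va' (update na [:: K] [:: (z : nat)]) (modal_term K (3 - s) a)))).
  rewrite va's va's'; case: ifP => [vw|_]; last by rewrite big1.
  rewrite -[RHS](minn_idPr (le_val w vw)) -sum_ltn_ord; apply: eq_bigr => z _.
  rewrite update_cons eqxx addn1 IHa // va's' (@eval_modal l a G w (va s)) //.
  congr (nat_of_bool (_ < _)); apply: eval_agree => x ltx.
  by rewrite update_cons; case: eqP => // eq_x; move: (lea : var_bound a <= K); lia.
Qed.

(* Counting [y < 1] for all number variables [y] of the formula closes it. *)
Lemma expressible_modal (e : expr l) (Q : unary_query l) : modal e ->
  (forall G (v : G) na, (v \in Q G) = (0 < eval v v na e)) ->
  expressible (@MFOC l) Q.
Proof.
move=> mod_e QE; set t := modal_term (var_bound e) 1 e.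
pose n := (\max_(y <- tfree_number t) y).+1.
pose ys := [seq (y, TOne : term l) | y <- iota 0 n].
(* The conjunct [FEq 1 1] makes the variable 1 occur freely even when [t] contains no vertex
   variable. *)
exists (FAnd (FEq 1 1) (FLe TOne (TCount [::] ys (FLe TOne t)))), 1.
have fst_ys : map fst ys = iota 0 n by rewrite -map_comp map_id.
have flat_ys (F : term l -> seq nat) : F TOne = [::] -> flatten [seq F p.2 | p <- ys] = [::].
  by move=> F1; rewrite /ys; elim: (iota 0 n) => //= y s ->; rewrite F1.
have ones y theta : List.In (y, theta) ys -> theta = TOne.
  by rewrite /ys; elim: (iota 0 n) => //= z s IHs [[_ <-]|].
have val_ys G (va : nat -> G) na : [seq term_value va na p.2 | p <- ys] = nseq n 1.
  rewrite /ys -map_comp -{2}(size_iota 0 n); elim: (iota 0 n) => //= z s IHs.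
  by congr (_ :: _).
move: ys fst_ys flat_ys ones val_ys => {}ys fst_ys flat_ys ones val_ys.
split.
- constructor; first by constructor.
  constructor; first by constructor.
  constructor; first by rewrite fst_ys iota_uniq.
    by move=> y theta /ones->; constructor.
  by constructor; [constructor | apply: modal_term_fragment].
- move=> x; rewrite /= (flat_ys (@tfree_vertex l)) // cats0 !inE mem_filter /=.
  by apply/idP/idP => [/or3P[//|//|/(modal_term_free _)]|->//]; rewrite inE; apply.
- rewrite /= (flat_ys (@tfree_number l)) // cats0 fst_ys.
  rewrite -[RHS](@filter_pred0 _ (tfree_number t)).
  apply: eq_in_filter => y y_t; rewrite mem_iota /= add0n ltnS.
  by rewrite (bigmaxn_sup_seq y).
move=> G va na.
rewrite -[RHS]/((va 1 == va 1) && (0 < term_value va na (TCount [::] ys (FLe TOne t)))).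
rewrite eqxx term_value_TCount0 val_ys.
rewrite (@eq_sum_below _ _ (fun=> va 1 \in Q G)) => [|s _]; last first.
  rewrite -[X in nat_of_bool X]/(0 < term_value (update va [::] [::]) _ t).
  by rewrite modal_term_value // -QE.
have -> b k : sum_below (nseq k 1) (fun=> nat_of_bool b) = b; last by rewrite lt0b.
by elim: k => //= k IHk; under eq_sum_below => s _ do rewrite big_ord1.
Qed.

End ToTerm.

Theorem theorem1p3 (l : nat) (Q : unary_query l) :
  expressible (@MFOC l) Q <-> expressible (@GFOC l) Q.
Proof.
split=> [[phi [x [phiM fv fn phiE]]]|[phi [x [phiG _ _ phiE]]]].
  by exists phi, x; split=> //; apply: (proj2 (fragment_sub l)).
(* Only [x] is free in [phi], so all vertex variables may be given the same value, which is the
   diagonal case. *)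
have [e eE] := proj2 (guarded_value l) phi phiG true.
have [m mod_m mE] := modal_diagonal e.
apply: (expressible_modal mod_m) => G v na.
by rewrite -mE -[e]/e -(eE G (fun=> v) na) // lt0b -phiE.
Qed.
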